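(* Let $G=(V,E)$ be an (unsigned) graph with $|V|=n$, regarded as the signed graph with $\sigma\equiv+1$, with edge weight $w\equiv1$, vertex measure $\mu\equiv1$ and potential $\kappa\equiv0$. Then $(L_1,L_2,\dots,L_{n-1},L_n)=(0,0,\dots,0,C)$ for some $C>0$ if and only if $G$ is the disjoint union of a star graph on $4C^2+1$ vertices and $n-4C^2-1$ isolated vertices.
   Context: $G=(V,E)$ is a finite undirected graph without self-loops, $V=\{1,\dots,n\}$. A star graph on $m+1$ vertices ($m\ge1$) is the complete bipartite graph $K_{1,m}$. For $p\ge1$ and nonzero $f$, $\mathcal R_p(f)=\frac{\sum_{\{i,j\}\in E}|f(i)-f(j)|^p}{\sum_i|f(i)|^p}$; $\mathcal S_p=\{f:\sum_i|f(i)|^p=1\}$; Krasnoselskii genus $\gamma(B)$ of closed symmetric $B\subset\mathbb R^n\setminus\{0\}$: least $k$ with an odd continuous map $B\to\mathbb R^k\setminus\{0\}$; $\mathcal F_k(\mathcal S_p)$ = closed symmetric $B\subset\mathcal S_p$ with $\gamma(B)\ge k$; $\lambda_k^{(p)}=\min_{B\in\mathcal F_k(\mathcal S_p)}\max_{f\in B}\mathcal R_p(f)$. Cut-off adjacency eigenvalues: $L_k:=\lim_{p\to\infty}2^{-p}\lambda_k^{(p)}$ (the limits exist). *)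

(* Defs.v *)
From HB Require Import structures.
From mathcomp Require Import all_boot all_order all_algebra.
From mathcomp Require Import all_classical all_reals all_analysis.
Set Implicit Arguments. Unset Strict Implicit. Unset Printing Implicit Defensive.
Import Order.TTheory GRing.Theory Num.Theory.
Import numFieldNormedType.Exports.
Local Open Scope classical_set_scope.
Local Open Scope ring_scope.

Definition simple_graph (n : nat) (e : rel 'I_n) : Prop :=
  (forall i j, e i j = e j i) /\ (forall i, ~~ e i i).

(* Functions f : V -> R are row vectors 'rV[R]_n, f(i) = f ord0 i. *)

Definition edge_sum (R : realType) (n : nat) (e : rel 'I_n) (p : R)
  (f : 'rV[R]_n) : R :=
  \sum_(i < n) \sum_(j < n | (i < j)%N && e i j) (`|f ord0 i - f ord0 j| `^ p).

Definition pnorm_p (R : realType) (n : nat) (p : R) (f : 'rV[R]_n) : R :=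
  \sum_(i < n) (`|f ord0 i| `^ p).

(* p-Rayleigh quotient with w = 1, mu = 1, kappa = 0, sigma = +1 *)
Definition rayleigh (R : realType) (n : nat) (e : rel 'I_n) (p : R)
  (f : 'rV[R]_n) : R := edge_sum e p f / pnorm_p p f.

Definition Sp (R : realType) (n : nat) (p : R) : set 'rV[R]_n :=
  [set f | pnorm_p p f = 1].

Definition odd_map_to (R : realType) (n k : nat) (B : set 'rV[R]_n) : Prop :=
  exists g : 'rV[R]_n -> 'rV[R]_k,
    [/\ {within B, continuous g},
        (forall x, B x -> g (- x) = - g x) &
        (forall x, B x -> g x != 0)].

(* Krasnoselskii genus gamma(B) >= k : no odd continuous map
   B -> R^j \ {0} for any j < k (gamma(B) = least such j, or infinity). *)
Definition genus_ge (R : realType) (n : nat) (B : set 'rV[R]_n) (k : nat) : Prop :=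
  forall j, (j < k)%N -> ~ odd_map_to j B.

Definition Fk (R : realType) (n : nat) (p : R) (k : nat) : set (set 'rV[R]_n) :=
  [set B : set 'rV[R]_n | [/\ closed B, (forall x, B x -> B (- x)), B `<=` Sp p & genus_ge B k]].

Definition lambda_p (R : realType) (n : nat) (e : rel 'I_n) (p : R) (k : nat) : R :=
  inf [set sup [set rayleigh e p f | f in B] | B in Fk p k].

Definition Lcut (R : realType) (n : nat) (e : rel 'I_n) (k : nat) : R :=
  lim ((fun p : R => 2 `^ (- p) * lambda_p e p k) @ +oo).

Definition star_plus_isolated (n : nat) (e : rel 'I_n) (m : nat) : Prop :=
  exists (c : 'I_n) (S : {set 'I_n}),
    [/\ #|S| = m, c \notin S &
        forall i j, e i j = ((i == c) && (j \in S)) || ((j == c) && (i \in S))].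

(* Main.v *)
Require Import Defs.
From HB Require Import structures.
From mathcomp Require Import all_boot all_order all_algebra.
From mathcomp Require Import all_classical all_reals all_analysis.
From mathcomp Require Import ring lra.
Import Order.TTheory GRing.Theory Num.Theory.
Import numFieldNormedType.Exports.
Set Implicit Arguments. Unset Strict Implicit. Unset Printing Implicit Defensive.

(** Substituting g_i = sign(f_i) |f_i|^(p/2) identifies all the spheres S_p with
    the Euclidean one, and turns 2^-p times the numerator of the Rayleigh quotient
    into a functional of g that decreases with p (convexity of powers) and that
    stays above the sum of - g_i g_j over any set of edges (AM-GM); in particular
    the limits L_k exist. A set of genus >= k meets the common zeros of any k-1 odd
    functions. For n-2 well chosen linear forms, a triangle or a pair of disjoint
    edges thus forces L_{n-1} >= 1/2, so that the edges must form a star. For a star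
    with m leaves, n-1 linear forms give L_n >= sqrt m / 2, a weighted convexity
    inequality gives the matching upper bound, and the hyperplane f(center) = 0,
    where the Rayleigh quotient is at most 1, gives L_k = 0 for k < n.

    That spheres have full genus is the Borsuk-Ulam theorem. It is proved on the
    l^1 sphere with chains modulo 2: h_{k+1} is the cone from e_{k+1}, cut into M
    thin layers, over the cycle h_k + A h_k, where A is the antipodal map. If an
    odd map G into R^j had no zero, label each vertex v by the coordinate where
    |G v| is largest, with its sign. Following Ky Fan, call a simplex alternating
    if the signs of its vertices alternate once these are sorted by coordinate:
    the number of alternating simplices of h_k has the same parity for all k, hence
    is odd. An alternating simplex with more than j vertices has two vertices with
    the same coordinate and opposite signs, although they are close; compactness
    then gives a zero of G as M grows. *)

(** * Chains modulo 2 and alternating simplices *)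

Section Mod2Chains.
Variable T : Type.
Implicit Types (s t : seq T) (c : seq (seq T)) (F : seq T -> bool).

(** A chain is a list of simplices counted modulo 2, and [F] is a cochain. *)
Definition chain_eval F c := \big[addb/false]_(s <- c) F s.

Fixpoint deletions s : seq (seq T) :=
  if s is v :: s' then s' :: map (cons v) (deletions s') else [::].

(** The prism operator: all simplices phi v_0, ..., phi v_i, psi v_i, ..., psi v_d. *)
Fixpoint prism (phi psi : T -> T) s : seq (seq T) :=
  if s is v :: s' then
    (phi v :: map psi s) :: map (cons (phi v)) (prism phi psi s')
  else [::].

Definition coboundary F s := chain_eval F (deletions s).

Lemma chain_eval_nil F : chain_eval F [::] = false.
Proof. by rewrite /chain_eval big_nil. Qed.

Lemma chain_eval_cons F s c : chain_eval F (s :: c) = F s (+) chain_eval F c.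
Proof. by rewrite /chain_eval big_cons. Qed.

Lemma chain_eval_cat F c d :
  chain_eval F (c ++ d) = chain_eval F c (+) chain_eval F d.
Proof. by rewrite /chain_eval big_cat. Qed.

Lemma chain_eval_map F (g : seq T -> seq T) c :
  chain_eval F (map g c) = chain_eval (F \o g) c.
Proof. by rewrite /chain_eval big_map. Qed.

Lemma chain_eval_flatten (I : Type) F (g : I -> seq (seq T)) (r : seq I) :
  chain_eval F (flatten (map g r)) = \big[addb/false]_(x <- r) chain_eval F (g x).
Proof. by rewrite /chain_eval big_flatten big_map. Qed.

Lemma eq_chain_eval F G c : F =1 G -> chain_eval F c = chain_eval G c.
Proof. by move=> FG; apply: eq_bigr. Qed.

Lemma chain_eval_addb F G c :
  chain_eval (fun s => F s (+) G s) c = chain_eval F c (+) chain_eval G c.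
Proof. by rewrite /chain_eval big_split. Qed.

Lemma coboundary_cons F v s :
  coboundary F (v :: s) = F s (+) coboundary (F \o cons v) s.
Proof. by rewrite /coboundary chain_eval_cons chain_eval_map. Qed.

Definition prism_eval phi psi F s := chain_eval F (prism phi psi s).

Lemma prism_eval_cons phi psi F v s :
  prism_eval phi psi F (v :: s) =
  F (phi v :: psi v :: map psi s) (+) prism_eval phi psi (F \o cons (phi v)) s.
Proof. by rewrite /prism_eval /= chain_eval_cons chain_eval_map. Qed.

Lemma prism_evalD phi psi F G s :
  prism_eval phi psi (fun s => F s (+) G s) s =
  prism_eval phi psi F s (+) prism_eval phi psi G s.
Proof. exact: chain_eval_addb. Qed.

Lemma coboundaryD F G s :
  coboundary (fun s => F s (+) G s) s = coboundary F s (+) coboundary G s.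
Proof. exact: chain_eval_addb. Qed.

Lemma coboundary_map (g : T -> T) F s :
  coboundary (F \o map g) s = coboundary F (map g s).
Proof.
elim: s F => [|v s IHs] F; first by rewrite /coboundary !chain_eval_nil.
by rewrite /= !coboundary_cons -IHs.
Qed.

(* The chain homotopy formula d P + P d = psi - phi, read modulo 2. *)
Lemma prism_coboundary phi psi F s :
  prism_eval phi psi (coboundary F) s (+) coboundary (prism_eval phi psi F) s =
  F (map psi s) (+) F (map phi s).
Proof.
elim: s F => [|v s IHs] F.
  have -> : coboundary (prism_eval phi psi F) [::] = false by exact: chain_eval_nil.
  have -> : prism_eval phi psi (coboundary F) [::] = false by exact: chain_eval_nil.
  by rewrite /= addbb.
rewrite prism_eval_cons coboundary_cons !coboundary_cons.
have -> : prism_eval phi psi (coboundary F \o cons (phi v)) s =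
    prism_eval phi psi F s (+)
    prism_eval phi psi (coboundary (F \o cons (phi v))) s.
  by rewrite -prism_evalD; apply: eq_chain_eval => t; rewrite /= coboundary_cons.
have -> : coboundary (prism_eval phi psi F \o cons v) s =
   coboundary (F \o cons (phi v) \o cons (psi v) \o map psi) s (+)
   coboundary (prism_eval phi psi (F \o cons (phi v))) s.
  by rewrite -coboundaryD; apply: eq_chain_eval => t; rewrite /= prism_eval_cons.
rewrite coboundary_map /=.
have := IHs (F \o cons (phi v)); rewrite /=.
move: (prism_eval _ _ (coboundary _) s) (coboundary (prism_eval _ _ _) s) => a b.
move: (coboundary _ (map psi s)) (prism_eval _ _ F s) => x y.
by case: a b x y (F _) (F (_ :: map psi s)) (F (_ :: map phi s)) => [] [] [] [] [] [] [].
Qed.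

End Mod2Chains.

(** * Alternating faces of a labelled simplex *)

Section FanCount.
Variables (T : Type) (lab : T -> nat) (sg : T -> bool).
Implicit Types (s t : seq T) (F : seq T -> bool).

Fixpoint alternating b s :=
  if s is v :: s' then (sg v == b) && alternating (~~ b) s' else true.

(** When a nonempty [s] alternates, only deleting an end vertex leaves an alternating face, and
    exactly one such face starts with [b]. When a single pair of neighbours has equal signs, the two
    faces that drop one of them cancel modulo 2. *)
Lemma coboundary_alternating b s :
  coboundary (alternating b) s = alternating b s (+) alternating (~~ b) s.
Proof.
elim: s b => [|v s IHs] b; first by rewrite /coboundary chain_eval_nil.
rewrite coboundary_cons /= negbK.
have [svb|svb] := eqVneq (sg v) b; last first.
  rewrite (_ : coboundary _ s = false); last by apply: big1 => t _ /=; rewrite (negPf svb).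
  by rewrite (_ : sg v == ~~ b) ?addbF //; case: (sg v) b svb => [] [].
rewrite svb (_ : (b == ~~ b) = false) ?addbF /=; last by case: (b).
rewrite (_ : coboundary _ s = coboundary (alternating (~~ b)) s).
  by rewrite IHs negbK addbC -addbA addbb addbF.
by apply: eq_chain_eval => t /=; rewrite svb eqxx.
Qed.

Fixpoint insert v s :=
  if s is w :: s' then
    if lab v <= lab w then v :: s else w :: insert v s'
  else [:: v].

Fixpoint insertion_sort s :=
  if s is v :: s' then insert v (insertion_sort s') else [::].

Lemma path_insert a v s : a <= lab v ->
  path leq a (map lab s) -> path leq a (map lab (insert v s)).
Proof.
elim: s a => [|w s IHs] a /= av; first by rewrite av.
case/andP=> aw ws; case: ifP => vw /=; first by rewrite av vw.
by rewrite aw IHs // ltnW // ltnNge vw.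
Qed.

Lemma sorted_insertion_sort s : sorted leq (map lab (insertion_sort s)).
Proof.
suff: path leq 0 (map lab (insertion_sort s)) by exact: path_sorted.
by elim: s => //= v s IHs; apply: path_insert.
Qed.

(** Deleting [v] gives back [s], and deleting another vertex commutes with the insertion: by
    sortedness [v] stays in front when the head behind it is deleted. *)
Lemma coboundary_insert F v s : sorted leq (map lab s) ->
  coboundary F (insert v s) = F s (+) coboundary (F \o insert v) s.
Proof.
elim: s F => [|w s IHs] F srt /=.
  by rewrite coboundary_cons /coboundary !chain_eval_nil.
have ws : sorted leq (map lab s) by exact: path_sorted srt.
case: ifP => vw.
  rewrite !coboundary_cons /=.
  congr (_ (+) (_ (+) _)).
    by case: s srt {IHs ws} => //= u s /andP[wu _]; rewrite (leq_trans vw wu).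
  by apply: eq_chain_eval => t /=; rewrite vw.
rewrite coboundary_cons IHs // coboundary_cons /= addbCA; congr (_ (+) (_ (+) _)).
by apply: eq_chain_eval => t /=; rewrite vw.
Qed.

Lemma coboundary_insertion_sort F s :
  coboundary (F \o insertion_sort) s = coboundary F (insertion_sort s).
Proof.
elim: s F => [|v s IHs] F //=; first by rewrite /coboundary !chain_eval_nil.
rewrite coboundary_cons coboundary_insert ?sorted_insertion_sort //=.
by rewrite -IHs.
Qed.

Definition fan b s := alternating b (insertion_sort s).

Lemma coboundary_fan b s : coboundary (fan b) s = fan b s (+) fan (~~ b) s.
Proof.
transitivity (coboundary (alternating b) (insertion_sort s)); last first.
  exact: coboundary_alternating.
exact: coboundary_insertion_sort.
Qed.

End FanCount.

Lemma perm_insertion_sort (T : eqType) (lab : T -> nat) (s : seq T) :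
  perm_eq (insertion_sort lab s) s.
Proof.
elim: s => //= v s IHs.
suff ins t : perm_eq (insert lab v t) (v :: t).
  by apply: perm_trans (ins _) _; rewrite perm_cons.
elim: t => //= w t IHt; case: ifP => // _.
apply: perm_trans (_ : perm_eq _ (w :: v :: t)) _; first by rewrite perm_cons.
exact/permEl/(perm_catCA [:: w] [:: v] t).
Qed.

(** Labels below [m] cannot increase strictly along more than [m] vertices, so two neighbours of the
    sorted list share a label; alternation gives them opposite signs. *)
Lemma fan_complementary (T : eqType) (lab : T -> nat) (sg : T -> bool) m b s :
  fan lab sg b s -> (forall v, v \in s -> lab v < m) -> m < size s ->
  exists v w, [/\ v \in s, w \in s, lab v = lab w & sg v != sg w].
Proof.
rewrite /fan; have prm := perm_insertion_sort lab s.
move: (insertion_sort _ s) (sorted_insertion_sort lab s) prm => t srt prm alt.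
rewrite -(perm_size prm) => labm.
have {}labm v : v \in t -> lab v < m by rewrite (perm_mem prm); exact: labm.
have memt := perm_mem prm.
suff: m < size t -> exists v w, [/\ v \in t, w \in t, lab v = lab w & sg v != sg w].
  by move=> H /H [v [w [vt wt lvw svw]]]; exists v, w; rewrite -!memt.
move: {s prm memt} srt alt labm => srt alt labm.
have [ltn_t|] := boolP (sorted ltn (map lab t)).
  move=> mt; suff: size t <= m by rewrite leqNgt mt.
  rewrite -(size_map lab) -(size_iota 0 m); apply: uniq_leq_size.
    exact: sorted_uniq ltn_trans ltnn _ ltn_t.
  by move=> _ /mapP[v vt ->]; rewrite mem_iota /= labm.
move=> + _; elim: t b srt alt {labm} => [//|v [//|w t] IHt] b.
move=> /= /andP[vw wt] /and3P[/eqP sv /eqP sw alt].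
have [lvw _|lvw] := eqVneq (lab v) (lab w).
  by exists v, w; rewrite !inE !eqxx orbT sv sw; split=> //; case: (b).
rewrite ltn_neqAle lvw vw /= => nwt.
have [//||x [y [xt yt lxy sxy]]] := IHt (~~ b) _ _ nwt; first by rewrite /= sw eqxx.
by exists x, y; rewrite !(in_cons v) xt yt !orbT.
Qed.

(** * Hemispheres as layered cones *)

Section Hemispheres.
Variables (T : eqType) (A : T -> T) (north : nat -> T).
Variables (M : nat) (push : nat -> nat -> T -> T).
Hypothesis AK : involutive A.
Hypothesis push0 : forall k v, push k 0 v = v.
Hypothesis pushM : forall k v, push k M v = north k.+1.

Definition symm (c : seq (seq T)) := c ++ map (map A) c.

Fixpoint hemi k : seq (seq T) :=
  if k is k'.+1 then
    flatten [seq flatten [seq prism (push k' t) (push k' t.+1) s | s <- symm (hemi k')]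
            | t <- iota 0 M]
  else [:: [:: north 0]].

Lemma chain_eval_symm F c :
  chain_eval F (symm c) = chain_eval F c (+) chain_eval (F \o map A) c.
Proof. by rewrite chain_eval_cat chain_eval_map. Qed.

(** By the prism formula, the boundaries of the layers of a cone over a cycle telescope to the cycle
    at level 0 and its image at level [M]. *)
Lemma coboundary_hemi_of_cycle F k :
  (forall G, chain_eval (coboundary G) (symm (hemi k)) = false) ->
  chain_eval (coboundary F) (hemi k.+1) = chain_eval F (symm (hemi k)).
Proof.
move=> cyc; rewrite /= chain_eval_flatten.
pose u t := chain_eval (F \o map (push k t)) (symm (hemi k)).
have step t : chain_eval (coboundary F)
    (flatten [seq prism (push k t) (push k t.+1) s | s <- symm (hemi k)]) =
    u t.+1 (+) u t.
  rewrite chain_eval_flatten -[RHS]addbF.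
  rewrite -[X in _ (+) X](cyc (prism_eval (push k t) (push k t.+1) F)) /u -!chain_eval_addb.
  rewrite [RHS]/chain_eval; apply: eq_bigr => s _.
  rewrite -[LHS]/(prism_eval _ _ _ s) -prism_coboundary.
  by rewrite -addbA addbb addbF.
under eq_bigr do rewrite step.
have -> : \big[addb/false]_(t <- iota 0 M) (u t.+1 (+) u t) = u M (+) u 0.
  elim: (M) => [|m IHm]; first by rewrite big_nil addbb.
  by rewrite -addn1 iotaD big_cat /= IHm big_seq1 add0n addn1 addbC addbA addbK.
(* At the apex both halves of [symm] collapse to the same degenerate simplices, which cancel. *)
have -> : u M = false.
  rewrite /u chain_eval_symm -chain_eval_addb /chain_eval big1 // => s _ /=.
  rewrite (_ : map _ (map A s) = map (push k M) s) ?addbb //.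
  by rewrite -map_comp; apply: eq_map => v /=; rewrite !pushM.
rewrite addFb /u; apply: eq_chain_eval => s /=.
by congr F; rewrite -[RHS]map_id; apply: eq_map.
Qed.

(** The boundary of h_{k+1} is h_k + A h_k, which [A] preserves, so h_{k+1} and A h_{k+1} have the
    same boundary. For k = 0, both points have the empty simplex as their only face. *)
Lemma symm_hemi_cycle G k : chain_eval (coboundary G) (symm (hemi k)) = false.
Proof.
rewrite chain_eval_symm.
rewrite [X in _ (+) X](eq_chain_eval (G := coboundary (G \o map A))); last first.
  by move=> s; rewrite coboundary_map.
elim: k G => [|k IHk] G.
  rewrite /= !chain_eval_cons !chain_eval_nil /coboundary /=.
  by rewrite !chain_eval_cons !chain_eval_nil !addbF addbb.
have cyc H : chain_eval (coboundary H) (symm (hemi k)) = false.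
  rewrite chain_eval_symm -[RHS](IHk H); congr (_ (+) _).
  by apply: eq_chain_eval => s; rewrite coboundary_map.
rewrite !coboundary_hemi_of_cycle // !chain_eval_symm.
rewrite [X in _ (+) (_ (+) X)](eq_chain_eval (G := G)); last first.
  by move=> s /=; congr G; rewrite -map_comp -[RHS]map_id; apply: eq_map.
by rewrite [X in _ (+) X]addbC addbb.
Qed.

Lemma coboundary_hemi F k :
  chain_eval (coboundary F) (hemi k.+1) = chain_eval F (symm (hemi k)).
Proof. by apply: coboundary_hemi_of_cycle => G; exact: symm_hemi_cycle. Qed.

Lemma in_flatten_map (I X : eqType) (f : I -> seq X) r x :
  x \in flatten (map f r) -> exists2 i, i \in r & x \in f i.
Proof. by case/flatten_mapP => i; exists i. Qed.

Lemma mem_prism phi psi s sigma : sigma \in prism phi psi s ->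
  size sigma = (size s).+1 /\
  forall v : T, v \in sigma -> exists2 w, w \in s & v = phi w \/ v = psi w.
Proof.
elim: s sigma => [|w s IHs] sigma //=; rewrite inE => /orP[/eqP ->|/mapP[t ts ->]].
  rewrite /= size_map; split=> // v; rewrite !inE => /or3P[/eqP->|/eqP->|/mapP[u us ->]].
  - by exists w; rewrite ?inE ?eqxx //; left.
  - by exists w; rewrite ?inE ?eqxx //; right.
  - by exists u; rewrite ?inE ?us ?orbT //; right.
have [szt IH] := IHs _ ts; split=> [|v]; rewrite /= ?szt // inE => /orP[/eqP->|/IH[u us vu]].
  by exists w; rewrite ?inE ?eqxx //; left.
by exists u; rewrite ?inE ?us ?orbT.
Qed.

Variables (lab : T -> nat) (sg : T -> bool).

(** The antipode keeps the labels, hence the sorting, and flips every sign. *)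
Lemma fan_antipode b s :
  (forall v, v \in s -> lab (A v) = lab v /\ sg (A v) = ~~ sg v) ->
  fan lab sg b (map A s) = fan lab sg (~~ b) s.
Proof.
move=> anti.
have -> : fan lab sg b (map A s) = alternating sg b (map A (insertion_sort lab s)).
  rewrite /fan; congr alternating.
  elim: s anti => //= v s IHs anti; rewrite IHs => [|w ws]; last first.
    by apply: anti; rewrite inE ws orbT.
  have mem w : w \in insertion_sort lab s -> w \in v :: s.
    by rewrite (perm_mem (perm_insertion_sort lab s)) inE orbC => ->.
  elim: (insertion_sort lab s) mem => //= w t IHt mem.
  have [-> _] := anti v (mem_head _ _); have [-> _] := anti w (mem w (mem_head _ _)).
  by case: ifP => //= _; rewrite IHt // => u ut; apply: mem; rewrite inE ut orbT.
rewrite /fan; have {}anti v : v \in insertion_sort lab s -> sg (A v) = ~~ sg v.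
  by rewrite (perm_mem (perm_insertion_sort lab s)) => /anti[].
elim: (insertion_sort lab s) b anti => //= v t IHt b anti.
rewrite anti ?mem_head // IHt => [|w wt]; last by apply: anti; rewrite inE wt orbT.
by case: (sg v) b => [] [].
Qed.

(* The number of alternating simplices has the same parity in all the hemispheres. *)
Lemma exists_alternating k :
  (forall i s v, i <= k -> s \in hemi i -> v \in s ->
     lab (A v) = lab v /\ sg (A v) = ~~ sg v) ->
  exists s b, s \in hemi k /\ fan lab sg b s.
Proof.
move=> anti.
have odd_count : chain_eval (fun s => fan lab sg true s (+) fan lab sg false s) (hemi k).
  elim: k anti => [|k IHk] anti.
    by rewrite chain_eval_cons chain_eval_nil /fan /= !andbT; case: (sg _).
  have {}IHk := IHk (fun i s v ik => anti i s v (leqW ik)).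
  (* The count of both kinds is the coboundary of [fan lab sg true]. On h_{k+1} it becomes the count
     of that one kind on h_k + A h_k, where the antipodal half counts the other kind on h_k. *)
  rewrite (eq_chain_eval (G := coboundary (fan lab sg true))) => [|s]; last first.
    by rewrite coboundary_fan.
  rewrite coboundary_hemi chain_eval_symm -chain_eval_addb.
  apply: etrans IHk; apply: eq_big_seq => s sk /=.
  by rewrite fan_antipode // => v; exact: anti (leqnSn k) sk.
have [/hasP[s sk]|/hasPn none] :=
  boolP (has (fun s => fan lab sg true s || fan lab sg false s) (hemi k)).
  by case/orP=> fs; exists s; [exists true|exists false].
suff : chain_eval (fun s => fan lab sg true s (+) fan lab sg false s) (hemi k) = false.
  by rewrite odd_count.
rewrite /chain_eval big1_seq // => s /andP[_ /none].
by rewrite negb_or => /andP[/negPf-> /negPf->].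
Qed.

End Hemispheres.

(** * The Borsuk-Ulam theorem *)

Local Open Scope classical_set_scope.
Local Open Scope ring_scope.

Section L1Sphere.
Variables (R : realType) (m : nat).
Implicit Types (x y v w : 'rV[R]_m).

Definition l1norm v : R := \sum_i `|v 0 i|.

Lemma l1norm_ge0 v : 0 <= l1norm v.
Proof. by apply: sumr_ge0 => i _. Qed.

Lemma l1normN v : l1norm (- v) = l1norm v.
Proof. by apply: eq_bigr => i _; rewrite mxE normrN. Qed.

Lemma l1normZ (a : R) v : l1norm (a *: v) = `|a| * l1norm v.
Proof. by rewrite mulr_sumr; apply: eq_bigr => i _; rewrite mxE normrM. Qed.

Lemma ler_l1normD v w : l1norm (v + w) <= l1norm v + l1norm w.
Proof. by rewrite -big_split; apply: ler_sum => i _; rewrite mxE ler_normD. Qed.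

Lemma ler_coord_l1norm v i : `|v 0 i| <= l1norm v.
Proof. by rewrite /l1norm (bigD1 i) //= lerDl sumr_ge0. Qed.

Lemma mx_norm_le v (c : R) : 0 <= c -> (forall i, `|v 0 i| <= c) -> `|v| <= c.
Proof.
move=> c0 vc; rewrite -[`|v|]/(mx_norm v) mx_normrE; apply: bigmax_le => // -[i j] _ /=.
by rewrite (ord1 i).
Qed.

Lemma ler_coord_mx_norm v i : `|v 0 i| <= `|v|.
Proof.
rewrite -[X in _ <= X]/(mx_norm v) mx_normrE.
exact: (le_bigmax _ (fun ij : 'I_1 * 'I_m => `|v ij.1 ij.2|) (0, i)).
Qed.

Lemma mx_norm_le_l1norm v : `|v| <= l1norm v.
Proof. by apply: mx_norm_le => [|i]; [exact: l1norm_ge0|exact: ler_coord_l1norm]. Qed.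

Definition l1sphere : set 'rV[R]_m := [set v | l1norm v = 1].

Lemma continuous_sum_coord (f : R -> R) :
  continuous f -> continuous (fun v => \sum_i f (v 0 i)).
Proof.
move=> cf; apply: continuous_big; first exact: add_continuous.
move=> i _ v; apply: (@continuous_comp _ _ _ (fun M : 'rV[R]_m => M 0 i) f); last exact: cf.
exact: coord_continuous.
Qed.

Lemma compact_l1sphere : compact l1sphere.
Proof.
apply: bounded_closed_compact.
  exists 1; split; first exact: num_real.
  move=> c c1 v /= v1; apply: le_trans (mx_norm_le_l1norm v) _.
  by rewrite v1 ltW.
have -> : l1sphere = l1norm @^-1` [set 1] by [].
apply: closed_comp; last exact: closed_eq.
by move=> v _; apply: continuous_sum_coord; exact: norm_continuous.
Qed.

End L1Sphere.
Arguments l1sphere : clear implicits.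

Section BorsukUlam.
Variables (R : realType) (m : nat).
Implicit Types (x y v w : 'rV[R]_m.+1).

Let north k : 'rV[R]_m.+1 := delta_mx 0 (inord k).

Let push (M : nat) k t v := (1 - t%:R / M%:R) *: v + (t%:R / M%:R) *: north k.+1.

Let near_equator k v := l1norm v = 1 /\ forall i : 'I_m.+1, (k < i)%N -> v 0 i = 0.

Let l1norm_north k : l1norm (north k) = 1.
Proof.
rewrite /l1norm (bigD1 (inord k)) //= mxE !eqxx normr1 big1 ?addr0 // => i ik.
by rewrite mxE (negPf ik) andbF normr0.
Qed.

(** As [v] has no component along the new pole, the l^1 norm of the convex combination is the
    combination of the norms: flat layers stay on the l^1 sphere. *)
Let near_equator_push M k t v : (0 < M)%N -> (k < m)%N -> (t <= M)%N ->
  near_equator k v -> near_equator k.+1 (push M k t v).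
Proof.
move=> M0 km tM [v1 vk]; have k1 : nat_of_ord (inord k.+1 : 'I_m.+1) = k.+1 by rewrite inordK.
have s0 : 0 <= t%:R / M%:R :> R by rewrite divr_ge0.
have s1 : t%:R / M%:R <= 1 :> R by rewrite ler_pdivrMr ?ltr0n // mul1r ler_nat.
rewrite /push; move: (t%:R / M%:R) s0 s1 => s s0 s1; split=> [|i ki]; last first.
  rewrite !mxE vk ?(ltnW ki) // mulr0 add0r eqxx /=.
  by rewrite -val_eqE /= k1 gtn_eqF // mulr0.
transitivity ((1 - s) * l1norm v + s * l1norm (north k.+1)); last first.
  by rewrite v1 l1norm_north !mulr1 subrK.
rewrite !mulr_sumr -big_split; apply: eq_bigr => i _ /=; rewrite !mxE eqxx /=.
have [->|ik] := eqVneq i (inord k.+1).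
  by rewrite vk ?k1 ?eqxx /= ?normr0 ?normr1 ?mulr0 ?add0r ?mulr1 ?ger0_norm.
by rewrite /= normr0 !mulr0 !addr0 normrM [`|1 - s|]ger0_norm // subr_ge0.
Qed.

Let l1norm_push M k t v w : (0 < M)%N -> (t <= M)%N ->
  l1norm (push M k t v - push M k t w) <= l1norm (v - w).
Proof.
move=> M0 tM; have -> : push M k t v - push M k t w = (1 - t%:R / M%:R) *: (v - w).
  by rewrite /push opprD addrACA subrr addr0 scalerBr.
have s0 : 0 <= t%:R / M%:R :> R by rewrite divr_ge0.
have s1 : t%:R / M%:R <= 1 :> R by rewrite ler_pdivrMr ?ltr0n // mul1r ler_nat.
rewrite l1normZ ger0_norm ?subr_ge0 // -[leRHS]mul1r ler_wpM2r ?l1norm_ge0 //.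
Qed.

(** Going up one layer moves [v] by 1/M times its difference with the pole, which has norm at most
    2. *)
Let l1norm_pushS M k t v w : (0 < M)%N -> (t < M)%N -> l1norm v = 1 ->
  l1norm (push M k t.+1 v - push M k t w) <= l1norm (v - w) + 2 / M%:R.
Proof.
move=> M0 tM v1.
have -> : push M k t.+1 v - push M k t w =
    (push M k t v - push M k t w) + M%:R^-1 *: (north k.+1 - v).
  rewrite /push; have -> : t.+1%:R / M%:R = t%:R / M%:R + M%:R^-1 :> R.
    by rewrite -natr1 mulrDl mul1r.
  by apply/rowP => i; rewrite !mxE; ring.
apply: le_trans (ler_l1normD _ _) _; apply: lerD; first exact: l1norm_push (ltnW tM).
rewrite l1normZ ger0_norm ?invr_ge0 // mulrC ler_wpM2r ?invr_ge0 //.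
by apply: le_trans (ler_l1normD _ _) _; rewrite l1normN v1 l1norm_north.
Qed.

(** Each cone step adds at most 2/M to the diameter, paid by pairs lying on two consecutive
    levels. *)
Let hemi_small M k s : (0 < M)%N -> (k <= m)%N ->
  s \in hemi (@GRing.opp _) north M (push M) k ->
  [/\ size s = k.+1, (forall v, v \in s -> near_equator k v) &
     forall v w, v \in s -> w \in s -> l1norm (v - w) <= 2 * k%:R / M%:R].
Proof.
move=> M0; elim: k s => [|k IHk] s km.
  rewrite inE => /eqP->; split=> // [v|v w].
    rewrite inE => /eqP ->; split=> // i i0.
    by rewrite mxE eqxx /= -val_eqE /= inordK // gtn_eqF.
  rewrite !inE => /eqP-> /eqP->.
  by rewrite subrr /l1norm big1 ?mulr0 ?mul0r // => i _; rewrite mxE normr0.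
rewrite /= => /in_flatten_map[t]; rewrite mem_iota add0n /= => tM.
move=> /in_flatten_map[c csymm /mem_prism[szs mems]].
have [szc eqc diamc] : [/\ size c = k.+1, (forall v, v \in c -> near_equator k v) &
     forall v w, v \in c -> w \in c -> l1norm (v - w) <= 2 * k%:R / M%:R].
  move: csymm; rewrite mem_cat => /orP[/IHk|/mapP[c' /IHk IH ->]].
    by apply; exact: ltnW.
  have [szc eqc diamc] := IH (ltnW km); rewrite size_map szc; split=> //.
    move=> _ /mapP[v vc ->]; have [v1 vk] := eqc v vc.
    by split=> [|i ki]; rewrite ?l1normN // mxE vk // oppr0.
  move=> _ _ /mapP[v vc ->] /mapP[w wc ->].
  by rewrite -opprD l1normN; exact: diamc.
split; first by rewrite szs szc.
  by move=> v /mems[w wc [] ->]; apply: near_equator_push (eqc _ wc) => //; exact: ltnW.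
have bound : 2 * k%:R / M%:R + 2 / M%:R = 2 * k.+1%:R / M%:R :> R.
  by rewrite -mulrDl -[k.+1]addn1 natrD mulrDr mulr1.
have le_bound : 2 * k%:R / M%:R <= 2 * k.+1%:R / M%:R :> R.
  by rewrite -bound lerDl divr_ge0.
move=> v w /mems[v' vc +] /mems[w' wc]; have d := diamc _ _ vc wc.
have [v1 _] := eqc _ vc; have [w1 _] := eqc _ wc.
case=> -> [] ->.
- by apply: le_trans le_bound; apply: le_trans d; apply: l1norm_push (ltnW tM).
- rewrite -opprB l1normN -bound.
  apply: le_trans (l1norm_pushS _ _ M0 tM w1) _.
  by rewrite -opprB l1normN lerD2r.
- by rewrite -bound; apply: le_trans (l1norm_pushS _ _ M0 tM v1) _; rewrite lerD2r.
- by apply: le_trans le_bound; apply: le_trans d; apply: l1norm_push.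
Qed.

(** For complementary vertices, [G v] and [G w] have opposite signs in the coordinate where both are
    largest, so they are at least [|G v|] apart. *)
Lemma odd_map_close_pair j (G : 'rV[R]_m.+1 -> 'rV[R]_j) M :
  (j <= m)%N -> (0 < M)%N ->
  (forall v, l1sphere R m.+1 v -> G (- v) = - G v) ->
  (forall v, l1sphere R m.+1 v -> G v != 0) ->
  exists v w, [/\ l1sphere R m.+1 v, l1sphere R m.+1 w,
    l1norm (v - w) <= 2 * m%:R / M%:R & `|G v| <= `|G v - G w|].
Proof.
case: j G => [|j] G jm M0 Godd Gneq0.
  (* For [j = 0] the target contains only zero; a positive [j] provides [ord0] for the arg max. *)
  by have /eqP[] := Gneq0 _ (l1norm_north 0); apply/rowP => -[].
pose lab v : nat := [arg max_(i > (ord0 : 'I_j.+1)) `|G v 0 i|]%O.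
pose top v := G v 0 (inord (lab v)).
have toptE v : top v = G v 0 [arg max_(i > (ord0 : 'I_j.+1)) `|G v 0 i|]%O.
  by rewrite /top inord_val.
have top_max v i : `|G v 0 i| <= `|top v|.
  by rewrite toptE; case: arg_maxP => // k _; exact.
have top_neq0 v : l1sphere R m.+1 v -> top v != 0.
  move=> v1; apply: contra_neq (Gneq0 _ v1) => top0; apply/rowP => i.
  by apply/eqP; rewrite mxE -normr_le0 (le_trans (top_max v i)) // top0 normr0.
have labN v : l1sphere R m.+1 v -> lab (- v) = lab v.
  move=> v1; rewrite /lab Godd //.
  suff -> : (fun i => `|(- G v) 0 i|) = (fun i => `|G v 0 i|) by [].
  by apply/funext => i; rewrite mxE normrN.
have [s [b [/hemi_small sH alt]]] : exists s b,
    s \in hemi (@GRing.opp _) north M (push M) m /\ fan lab (fun v => 0 < top v) b s.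
  apply: exists_alternating => [v|k v|k v|i s v im /hemi_small[]//]; first exact: opprK.
  - by rewrite /push mul0r subr0 scale1r scale0r addr0.
  - by rewrite /push divff ?pnatr_eq0 -?lt0n // subrr scale0r scale1r add0r.
  - move=> _ eqv _ vs; have [v1 _] := eqv v vs.
    rewrite labN //; split=> //; rewrite /top labN // Godd // mxE oppr_gt0.
    by have := top_neq0 v v1; rewrite /top; case: ltgtP.
have [//|//|szs eqs diam] := sH.
(* A simplex has m + 1 vertices, more than the j + 1 labels. *)
have [v [w [vs ws lvw svw]]] : exists v w, [/\ v \in s, w \in s, lab v = lab w &
    (0 < top v) != (0 < top w)].
  apply: (fan_complementary (m := j.+1)) alt _ _; last by rewrite szs ltnS.
  by move=> v _; exact: ltn_ord.
have [[v1 _] [w1 _]] := (eqs v vs, eqs w ws).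
exists v, w; split=> //; first exact: diam.
apply: (@le_trans _ _ `|top v|); first by apply: mx_norm_le => // i; exact: top_max.
apply: le_trans (ler_coord_mx_norm _ (inord (lab v))).
rewrite !mxE {2}lvw -/(top v) -/(top w).
have := top_neq0 _ v1; have := top_neq0 _ w1; move: svw.
case: (ltgtP 0 (top v)) => // tv; case: (ltgtP 0 (top w)) => // tw _ _ _.
  by rewrite gtr0_norm // gtr0_norm ?subr_gt0 ?(lt_trans tw) // lerDl oppr_ge0 ltW.
rewrite ltr0_norm // ltr0_norm ?subr_lt0 ?(lt_trans tv) //.
by rewrite opprB lerDr ltW.
Qed.

(** Without a zero there are ever closer pairs whose images stay apart; by compactness they
    accumulate at a point where continuity fails. *)
Theorem borsuk_ulam j (G : 'rV[R]_m.+1 -> 'rV[R]_j) : (j <= m)%N ->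
  {within l1sphere R m.+1, continuous G} ->
  (forall v, l1sphere R m.+1 v -> G (- v) = - G v) ->
  exists2 v, l1sphere R m.+1 v & G v = 0.
Proof.
move=> jm /subspace_continuousP Gcont Godd; apply: contrapT => nozero.
have Gneq0 v : l1sphere R m.+1 v -> G v != 0.
  by move=> v1; apply/eqP => Gv0; apply: nozero; exists v.
have /choice[vw vwP] : forall M : nat, exists vw : 'rV[R]_m.+1 * 'rV[R]_m.+1,
    [/\ l1sphere R m.+1 vw.1, l1sphere R m.+1 vw.2,
    l1norm (vw.1 - vw.2) <= 2 * m%:R / M.+1%:R & `|G vw.1| <= `|G vw.1 - G vw.2|].
  move=> M; have [v [w vwP]] := odd_map_close_pair jm (ltn0Sn M) Godd Gneq0.
  by exists (v, w).
have [|x [x1 xcl]] := @compact_l1sphere R m.+1 ((fun M => (vw M).1) @ \oo) _.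
  by exists 0%N => // M _ /=; have [] := vwP M.
have Gx : 0 < `|G x| by rewrite normr_gt0 Gneq0.
(* If [G v] and [G w] are within |G x|/3 of [G x], then |G v - G w| < 2|G x|/3 < |G v|. *)
have Gx3 : 0 < `|G x| / 3 by rewrite divr_gt0.
have /cvgrPdist_lt/(_ _ Gx3)/nbhs_ballP[d /= d0 ball_d] := Gcont x x1.
have close v : l1sphere R m.+1 v -> `|x - v| < d -> `|G x - G v| < `|G x| / 3.
  by move=> v1 xv; apply: ball_d v1; rewrite -ball_normE.
(* Beyond [M0] the pair is closer than d/2, which leaves d/2 for the distance to [x]. *)
pose M0 := Num.bound (4 * m%:R / d).
have far M : (M0 <= M)%N -> 2 * m%:R / M.+1%:R < d / 2.
  move=> M0M; rewrite ltr_pdivrMr ?ltr0n //.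
  have : 4 * m%:R / d < M0%:R by apply: archi_boundP; rewrite divr_ge0 ?mulr_ge0 // ltW.
  rewrite ltr_pdivrMr // => bnd.
  have : d * M0%:R <= d * M.+1%:R by rewrite ler_pM2l // ler_nat ltnW.
  by move: (M.+1%:R) (M0%:R) bnd => a b; nra.
have tail : \forall v \near (vw M).1 @[M --> \oo], exists2 M, (M0 <= M)%N & v = (vw M).1.
  by exists M0 => // M /= M0M; exists M.
have [v [[M M0M ->]]] := xcl _ _ tail (nbhsx_ballx x (d / 2) (divr_gt0 d0 (ltr0Sn _ 1))).
rewrite -ball_normE /= => xv.
have [v1 w1 vw_close Gvw] := vwP M; move: Gvw; apply/negP; rewrite -ltNge.
have xw : `|x - (vw M).2| < d.
  rewrite -[_ - _](subrKA (vw M).1) (le_lt_trans (ler_normD _ _)) //.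
  rewrite [ltRHS]splitr ltrD //; apply: le_lt_trans (mx_norm_le_l1norm _) _.
  exact: le_lt_trans vw_close (far M M0M).
have := close _ v1 (lt_trans xv _); rewrite gtr_pMr // => /(_ _)Gv.
have {}Gv : `|G x - G (vw M).1| < `|G x| / 3 by apply: Gv; lra.
have Gw := close _ w1 xw.
have := ler_distD (G x) (G (vw M).1) (G (vw M).2).
rewrite (distrC (G (vw M).1) (G x)).
have := ler_distD (G (vw M).1) (G x) 0; rewrite !subr0.
by move: Gv Gw; lra.
Qed.

End BorsukUlam.

(** * Signed powers *)

Section SignedPower.
Variable R : realType.
Implicit Types a b p r t x y : R.

Definition spow r x : R := Num.sg x * `|x| `^ r.

Lemma spowN r x : spow r (- x) = - spow r x.
Proof. by rewrite /spow sgrN normrN mulNr. Qed.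

Lemma spow0 r : spow r 0 = 0.
Proof. by rewrite /spow sgr0 mul0r. Qed.

Lemma ge0_spow r x : 0 < r -> 0 <= x -> spow r x = x `^ r.
Proof.
move=> r0; rewrite le_eqVlt => /predU1P[<-|x0]; first by rewrite spow0 powR0 ?gt_eqF.
by rewrite /spow gtr0_sg // mul1r gtr0_norm.
Qed.

Lemma normr_spow r x : 0 < r -> `|spow r x| = `|x| `^ r.
Proof.
move=> r0; have [->|x0] := eqVneq x 0; first by rewrite spow0 normr0 powR0 ?gt_eqF.
by rewrite normrM normr_sg x0 mul1r ger0_norm ?powR_ge0.
Qed.

Lemma spowM a b x : 0 < a -> spow b (spow a x) = spow (a * b) x.
Proof.
move=> a0; rewrite {1}/spow normr_spow // -powRrM.
have [->|x0] := eqVneq x 0; first by rewrite !spow0 sgr0 mul0r.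
by rewrite /spow sgrM sgr_id [Num.sg (_ `^ _)]gtr0_sg ?mulr1 // powR_gt0 ?normr_gt0.
Qed.

Lemma spow1 x : spow 1 x = x.
Proof. by rewrite /spow powRr1 // -numEsg. Qed.

(** At 0, |y| < e^(1/r) gives |y|^r < e; elsewhere the sign is locally constant. *)
Lemma continuous_spow r : 0 < r -> continuous (spow r).
Proof.
move=> r0 x; have [->|x0] := eqVneq x 0.
  apply/cvgrPdist_lt => e e0; rewrite spow0.
  have d0 : 0 < e `^ r^-1 by exact: powR_gt0.
  apply/nbhs_ballP; exists (e `^ r^-1) => // y.
  rewrite /ball /= !sub0r !normrN normr_spow // => ye.
  have := @gt0_ltr_powR R r r0 `|y| (e `^ r^-1).
  rewrite !nnegrE normr_ge0 powR_ge0 => /(_ isT isT ye).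
  by rewrite -powRrM mulVf ?gt_eqF // powRr1 // ltW.
have : (fun y => Num.sg x * expR (r * ln `|y|)) @ x --> spow r x.
  rewrite /spow /powR normr_eq0 (negPf x0); apply: cvgMr.
  apply: continuous_comp; last exact: continuous_expR.
  apply: cvgMr; apply: continuous_comp; first exact: norm_continuous.
  by apply: continuous_ln; rewrite normr_gt0.
apply: cvg_trans; apply: near_eq_cvg.
apply/nbhs_ballP; exists `|x| => [|y]; rewrite /ball /= ?normr_gt0 // => yx.
have y0 : y != 0 by apply: contraTneq yx => ->; rewrite subr0 ltxx.
rewrite /spow /powR normr_eq0 (negPf y0).
case: (ltgtP x 0) x0 yx => // [x0|x0] _.
  rewrite (ltr0_norm x0) ltr_norml => /andP[? ?].
  by rewrite (ltr0_sg x0) ltr0_sg //; lra.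
rewrite (gtr0_norm x0) ltr_norml => /andP[? ?].
by rewrite (gtr0_sg x0) gtr0_sg //; lra.
Qed.

Lemma powR_convex r t x y : 1 <= r -> 0 <= t <= 1 -> 0 <= x -> 0 <= y ->
  (t * x + (1 - t) * y) `^ r <= t * x `^ r + (1 - t) * y `^ r.
Proof.
move=> r1 /andP[t0 t1] x0 y0.
have := @convex_powR R r r1 (Itv01 t0 t1) x y.
rewrite !inE /= !in_itv /= x0 y0 => /(_ isT isT).
by rewrite !convRE.
Qed.

(** Superadditivity: x^r = x x^(r-1) <= x (x+y)^(r-1), likewise for y, and the bounds add up. *)
Lemma powR_subadd r x y : 1 <= r -> 0 <= x -> 0 <= y ->
  x `^ r + y `^ r <= (x + y) `^ r.
Proof.
move=> r1 x0 y0; have r0 : 0 < r by exact: lt_le_trans ltr01 r1.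
rewrite -[x `^ r]mulr_powRB1 // -[y `^ r]mulr_powRB1 //.
rewrite -[(x + y) `^ r]mulr_powRB1 ?addr_ge0 //.
by rewrite mulrDl lerD // ler_wpM2l // ge0_ler_powR ?nnegrE ?subr_ge0 ?addr_ge0 ?lerDl ?lerDr.
Qed.

(* With r = q / p, this makes the rescaled edge energy nonincreasing in the exponent. *)
Lemma powR_dist_half r x y : 1 <= r ->
  (`|x - y| / 2) `^ r <= `|spow r x - spow r y| / 2.
Proof.
move=> r1; have r0 : 0 < r by exact: lt_le_trans ltr01 r1.
wlog yx : x y / `|y| <= `|x|.
  by move=> H; case: (leP `|y| `|x|) => [/H//|/ltW/H]; rewrite distrC [`|spow _ _ - _|]distrC.
wlog x0 : x y yx / 0 <= x.
  move=> H; case: (leP 0 x) => [/H->//|x0].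
  have := H (- x) (- y); rewrite !normrN oppr_ge0 => /(_ yx (ltW x0)).
  by rewrite !spowN -!opprD !normrN.
move: yx; rewrite (ger0_norm x0) => yx.
(* Same signs: (x-y)^r <= x^r - y^r by superadditivity, and 2^-r <= 1/2. *)
have [y0|y0] := leP 0 y.
  move: yx; rewrite (ger0_norm y0) => yx.
  rewrite !ge0_spow // !ger0_norm ?subr_ge0 ?ge0_ler_powR ?nnegrE ?(ltW r0) //.
  have := @powR_subadd r (x - y) y r1; rewrite subr_ge0 subrK => /(_ yx y0).
  have : ((x - y) / 2) `^ r <= (x - y) `^ r / 2.
    rewrite powRM ?subr_ge0 ?invr_ge0 // ler_wpM2l ?powR_ge0 //.
    by apply: ge1r_powR => //; lra.
  lra.
(* Opposite signs: convexity at the midpoint of x and -y. *)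
have ny : 0 <= - y by rewrite oppr_ge0 ltW.
have -> : spow r y = - (- y) `^ r by rewrite -[y in LHS]opprK spowN ge0_spow.
rewrite ge0_spow // opprK.
have -> : `|x - y| = x + - y by rewrite ger0_norm // subr_ge0 (le_trans (ltW y0)).
rewrite ger0_norm ?addr_ge0 ?powR_ge0 //.
have := @powR_convex r 2^-1 x (- y) r1 _ x0 ny.
rewrite (_ : 1 - 2^-1 = 2^-1); last by field.
by rewrite -!mulrDr !(mulrC 2^-1); apply; lra.
Qed.

(** For opposite signs, |x||y| <= ((|x|+|y|)/2)^2 = (|x-y|/2)^2 is raised to the power p/2;
    otherwise the left side is nonpositive. *)
Lemma amgm_spow p x y : 0 < p ->
  - (spow (p / 2) x * spow (p / 2) y) <= (`|x - y| / 2) `^ p.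
Proof.
move=> p0; have p20 : 0 < p / 2 by rewrite divr_gt0.
have [xy|xy] := leP 0 (x * y).
  apply: le_trans (powR_ge0 _ _); rewrite oppr_le0 /spow mulrACA -sgrM.
  by rewrite mulr_ge0 ?sgr_ge0 // mulr_ge0 // powR_ge0.
rewrite /spow mulrACA -sgrM (ltr0_sg xy) mulN1r opprK -powRM //.
have -> : p = 2 * (p / 2) by field.
rewrite [X in _ <= X]powRrM (_ : 2 * (p / 2) / 2 = p / 2); last by field.
apply: ge0_ler_powR; rewrite ?nnegrE ?mulr_ge0 ?powR_ge0 ?(ltW p20) ?(ltW p0) //.
rewrite -normrM ltr0_norm // powR_mulrn ?divr_ge0 // expr_div_n real_normK ?num_real //.
have := sqr_ge0 (x + y); rewrite !expr2; lra.
Qed.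

(** Convexity with weights u/(1+u) and 1/(1+u) at x(1+u)/u and y(1+u), whose mean is x + y; [u] is
    left free for optimization. *)
Lemma powRD_weighted p u x y : 1 < p -> 0 < u -> 0 <= x -> 0 <= y ->
  (x + y) `^ p <= (1 + u) `^ (p - 1) * (u `^ (1 - p) * x `^ p + y `^ p).
Proof.
move=> p1 u0 x0 y0; have u1 : 0 < 1 + u by rewrite addr_gt0.
have := @powR_convex p (u / (1 + u)) (x * ((1 + u) / u)) (y * (1 + u)) (ltW p1).
have -> : 1 - u / (1 + u) = (1 + u)^-1 by field; rewrite gt_eqF.
have -> : u / (1 + u) * (x * ((1 + u) / u)) + (1 + u)^-1 * (y * (1 + u)) = x + y.
  by field; rewrite !gt_eqF.
have t01 : 0 <= u / (1 + u) <= 1.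
  by rewrite divr_ge0 ?(ltW u0) ?(ltW u1) //= ler_pdivrMr // mul1r lerDr.
have u1u : 0 <= (1 + u) / u by rewrite divr_ge0 // ltW.
have xu : 0 <= x * ((1 + u) / u) by exact: mulr_ge0.
have yu : 0 <= y * (1 + u) by rewrite mulr_ge0 // ltW.
move=> /(_ t01 xu yu) h; apply: le_trans h _.
rewrite !powRM ?invr_ge0 ?(ltW u0) ?(ltW u1) // -[u^-1]powR_inv1 ?(ltW u0) //.
rewrite -powRrM mulN1r.
have -> : (1 + u) `^ p = (1 + u) * (1 + u) `^ (p - 1).
  by rewrite mulr_powRB1 ?(ltW u1) // (lt_trans ltr01).
have -> : u `^ (1 - p) = u * u `^ (- p).
  rewrite powRD; last by rewrite (gt_eqF u0) implybT.
  by rewrite powRr1 // ltW.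
rewrite le_eqVlt; apply/orP; left; apply/eqP; field; rewrite !gt_eqF //.
Qed.

End SignedPower.

(** * Genus of spheres *)

Lemma continuous_addr (R : realType) (T : topologicalType) (f g : T -> R) :
  continuous f -> continuous g -> continuous (fun x => f x + g x).
Proof. by move=> cf cg x; apply: cvgD; [exact: cf|exact: cg]. Qed.

Lemma continuous_mulr_cst (R : realType) (T : topologicalType) (k : R) (f : T -> R) :
  continuous f -> continuous (fun x => k * f x).
Proof. by move=> cf x; apply: cvgMr; exact: cf. Qed.

Section Genus.
Variable R : realType.

Lemma cvg_row (T : Type) (F : set_system T) (FF : Filter F) n
    (f : T -> 'rV[R]_n) (l : 'rV[R]_n) :
  (forall i, f x 0 i @[x --> F] --> l 0 i) -> f x @[x --> F] --> l.
Proof.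
move=> fl; apply/cvgrPdist_le => e e0.
have : \forall x \near F, forall i, `|l 0 i - f x 0 i| <= e.
  by apply: filter_forall => i; have /cvgrPdist_le/(_ e e0) := fl i.
by apply: filterS => x xe; apply: mx_norm_le (ltW e0) _ => i; rewrite !mxE.
Qed.

Lemma continuous_row (T : topologicalType) n (f : T -> 'rV[R]_n) :
  (forall i, continuous (fun x => f x 0 i)) -> continuous f.
Proof. by move=> cf x; apply: cvg_row => i; exact: cf. Qed.

(** Composition with [h] turns an odd nonvanishing map on [B'] into one on [B]. *)
Lemma genus_ge_map m n k (h : 'rV[R]_m -> 'rV[R]_n) (B : set 'rV[R]_m)
    (B' : set 'rV[R]_n) :
  continuous h -> (forall x, h (- x) = - h x) -> (forall x, B x -> B' (h x)) ->
  genus_ge B k -> genus_ge B' k.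
Proof.
move=> ch oddh hB gB j jk [g [/subspace_continuousP cg oddg g0]].
apply: (gB j jk); exists (g \o h); split=> [|x Bx|x Bx] /=; last exact: g0 (hB _ Bx).
  apply/subspace_continuousP => x Bx U gU.
  have /ch hU := cg (h x) (hB x Bx) U gU.
  move: hU; apply: (@filterS _ (nbhs x)) => y /= yU By; apply: yU; exact: hB. 
by rewrite oddh oddg //; exact: hB.
Qed.

Lemma genus_ge_l1sphere m : genus_ge (l1sphere R m) m.
Proof.
case: m => [//|m] j; rewrite ltnS => jm [g [cg oddg g0]].
by have [v v1 /eqP] := borsuk_ulam jm cg oddg; rewrite (negPf (g0 v v1)).
Qed.

Lemma genus_ge_le n (B : set 'rV[R]_n) j k : (j <= k)%N -> genus_ge B k -> genus_ge B j.
Proof. by move=> jk gB i ij; apply: gB; exact: leq_trans jk. Qed.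

(** Otherwise the [phi i] with [i] in [D] are the coordinates of an odd nonvanishing map into
    dimension [#|D|]. Each constraint is thus attached to a vertex. *)
Lemma genus_ge_zero n (B : set 'rV[R]_n) k (D : {set 'I_n})
    (phi : 'I_n -> 'rV[R]_n -> R) :
  genus_ge B k -> (#|D| < k)%N -> (forall i, continuous (phi i)) ->
  (forall i x, phi i (- x) = - phi i x) ->
  exists2 x, B x & forall i, i \in D -> phi i x = 0.
Proof.
move=> gB Dk cphi oddphi; apply: contrapT => nozero; apply: (gB _ Dk).
exists (fun x => \row_(i < #|D|) phi (enum_val i) x); split=> [|x Bx|x Bx].
- apply: continuous_subspaceT; apply: continuous_row => i x.
  have -> : (fun y => (\row_(i < #|D|) phi (enum_val i) y) 0 i) = phi (enum_val i).
    by apply/funext => y; rewrite mxE.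
  exact: cphi.
- by apply/rowP => i; rewrite !mxE oddphi.
apply/eqP => x0; apply: nozero; exists x => // i iD.
by have := congr1 (fun v : 'rV__ => v 0 (enum_rank_in iD i)) x0; rewrite !mxE enum_rankK_in.
Qed.

Lemma genus_ge_nonempty n (B : set 'rV[R]_n) k : (0 < k)%N -> genus_ge B k -> B !=set0.
Proof.
move=> k0 gB.
have [|x y|x y|x Bx _] := genus_ge_zero (D := finset.set0) (phi := fun _ _ => 0) gB.
- by rewrite cards0.
- exact: cst_continuous.
- by rewrite oppr0.
- by exists x.
Qed.

End Genus.

(** * Power maps between the spheres S_p *)

Section VectorPower.
Variables (R : realType) (n : nat).
Implicit Types (f : 'rV[R]_n) (p q r : R) (B : set 'rV[R]_n).

Definition vspow r f : 'rV[R]_n := map_mx (spow r) f.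

Lemma continuous_coord_spow r i : 0 < r -> continuous (fun f => spow r (f 0 i)).
Proof.
move=> r0 f; apply: (@continuous_comp _ _ _ (fun f : 'rV[R]_n => f 0 i) (spow r)).
  exact: coord_continuous.
exact: continuous_spow.
Qed.

Lemma continuous_vspow r : 0 < r -> continuous (vspow r).
Proof.
move=> r0; apply: continuous_row => i.
have -> : (fun f => vspow r f 0 i) = (fun f => spow r (f 0 i)).
  by apply/funext => f; rewrite mxE.
exact: continuous_coord_spow.
Qed.

Lemma vspowN r f : vspow r (- f) = - vspow r f.
Proof. by apply/rowP => i; rewrite !mxE spowN. Qed.

Lemma vspowK r s f : 0 < r -> r * s = 1 -> vspow s (vspow r f) = f.
Proof. by move=> r0 rs; apply/rowP => i; rewrite !mxE spowM // rs spow1. Qed.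

Lemma pnorm_vspow r p f : 0 < r -> pnorm_p p (vspow r f) = pnorm_p (r * p) f.
Proof. by move=> r0; apply: eq_bigr => i _; rewrite mxE normr_spow // powRrM. Qed.

Lemma pnorm1 f : pnorm_p 1 f = l1norm f.
Proof. by apply: eq_bigr => i _; rewrite powRr1. Qed.

Lemma closed_Sp p : 0 < p -> closed (@Sp R n p).
Proof.
move=> p0; have -> : @Sp R n p = pnorm_p p @^-1` [set 1] by [].
apply: closed_comp; last exact: closed_eq.
move=> f _; apply: (@continuous_sum_coord R n (fun x => `|x| `^ p)).
have -> : (fun x : R => `|x| `^ p) = (fun x => spow p `|x|).
  by apply/funext => x; rewrite ge0_spow.
move=> x; apply: (@continuous_comp _ _ _ (fun x : R => `|x|) (spow p)).
  exact: norm_continuous.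
exact: continuous_spow.
Qed.

Lemma SpN p f : Sp p f -> Sp p (- f).
Proof.
rewrite /Sp /= => <-; apply: eq_bigr => i _.
by rewrite mxE normrN.
Qed.

Lemma Fk_Sp p k : 0 < p -> (k <= n)%N -> Fk p k (@Sp R n p).
Proof.
move=> p0 kn; split=> //; first exact: closed_Sp.
  by move=> x; exact: SpN.
apply: genus_ge_le kn _; apply: genus_ge_map (@genus_ge_l1sphere R n).
- by apply: (@continuous_vspow p^-1); rewrite invr_gt0.
- exact: vspowN.
- by move=> x x1; rewrite /Sp /= pnorm_vspow ?invr_gt0 // mulVf ?gt_eqF // pnorm1.
Qed.

(** Taking a preimage makes closedness immediate; the inverse power p/q carries the genus over. *)
Lemma Fk_vspow p q k B : 0 < p -> 0 < q -> Fk p k B ->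
  Fk q k [set f | B (vspow (q / p) f)].
Proof.
move=> p0 q0 [cB oB BS gB]; have qp : 0 < q / p by rewrite divr_gt0.
have pq : 0 < p / q by rewrite divr_gt0.
split.
- by apply: closed_comp cB => f _; exact: continuous_vspow.
- by move=> f /= Bf; rewrite vspowN; exact: oB.
- by move=> f /= /BS; rewrite /Sp /= pnorm_vspow // divfK ?gt_eqF.
- apply: genus_ge_map gB; [exact: (continuous_vspow pq)|exact: vspowN|].
  by move=> f Bf /=; rewrite vspowK // mulrA divfK ?divff ?gt_eqF.
Qed.

End VectorPower.

(** * Hyperplane sections of S_p *)

Section HyperplaneSection.
Variables (R : realType) (m : nat) (c : 'I_m.+1).

(** Taking powers 1/p and inserting a zero at [c] maps the l^1 sphere of R^m oddly into the
    section. *)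
Lemma Fk_hyperplane (p : R) k : 0 < p -> (k <= m)%N ->
  Fk p k [set f : 'rV[R]_m.+1 | Sp p f /\ f 0 c = 0].
Proof.
move=> p0 km; split.
- apply: closedI; first exact: closed_Sp.
  have -> : (fun f : 'rV[R]_m.+1 => f 0 c = 0) =
    (fun f : 'rV[R]_m.+1 => f 0 c) @^-1` [set 0] by [].
  by apply: closed_comp; [move=> f _; exact: coord_continuous|exact: closed_eq].
- by move=> f [/SpN Sf fc]; split; rewrite // mxE fc oppr0.
- by move=> f [].
apply: genus_ge_le km _.
pose h (x : 'rV[R]_m) : 'rV[R]_m.+1 := \row_i oapp (fun j => spow p^-1 (x 0 j)) 0 (unlift c i).
have pV : 0 < p^-1 by rewrite invr_gt0.
apply: (@genus_ge_map _ _ _ _ h) (@genus_ge_l1sphere R m).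
- apply: continuous_row => i.
  have -> : (fun x => h x 0 i) = (fun x => oapp (fun j => spow p^-1 (x 0 j)) 0 (unlift c i)).
    by apply/funext => x; rewrite mxE.
  by case: unliftP => [j _|_]; [exact: continuous_coord_spow|exact: cst_continuous].
- move=> x; apply/rowP => i; rewrite !mxE.
  by case: unliftP => [j _|_] /=; rewrite ?oppr0 // mxE spowN.
move=> x x1; split; last by rewrite mxE unlift_none.
rewrite /Sp /= /pnorm_p (bigD1_ord c) //= mxE unlift_none normr0 powR0 ?gt_eqF // add0r.
rewrite -[RHS]x1; apply: eq_bigr => j _.
by rewrite mxE liftK normr_spow // -powRrM mulVf ?gt_eqF // powRr1.
Qed.

End HyperplaneSection.

(** * Variational eigenvalues *)

Section Eigenvalues.
Variables (R : realType) (n : nat) (e : rel 'I_n).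
Implicit Types (f : 'rV[R]_n) (p q c : R) (B : set 'rV[R]_n).

Lemma edge_sum_ge0 p f : 0 <= edge_sum e p f.
Proof. by apply: sumr_ge0 => i _; apply: sumr_ge0 => j _; exact: powR_ge0. Qed.

Lemma rayleigh_Sp p f : Sp p f -> rayleigh e p f = edge_sum e p f.
Proof. by rewrite /Sp /rayleigh /= => ->; rewrite divr1. Qed.

Lemma coord_Sp p f i : 0 < p -> Sp p f -> `|f 0 i| <= 1.
Proof.
move=> p0 Sf; have : `|f 0 i| `^ p <= 1.
  rewrite -[leRHS]Sf /pnorm_p (bigD1 i) //= lerDl.
  by apply: sumr_ge0 => j _; exact: powR_ge0.
apply: contraTT; rewrite -!ltNge => f1.
have := @gt0_ltr_powR R p p0 1 `|f 0 i|.
by rewrite !nnegrE ler01 normr_ge0 powR1; exact.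
Qed.

Lemma edge_sum_bound p : 0 < p ->
  exists c, forall f, Sp p f -> edge_sum e p f <= c.
Proof.
move=> p0; exists (\sum_(i < n) \sum_(j < n | (i < j)%N && e i j) 2 `^ p) => f Sf.
apply: ler_sum => i _; apply: ler_sum => j _.
rewrite ge0_ler_powR ?nnegrE ?(ltW p0) //.
by apply: le_trans (ler_normB _ _) _; apply: (lerD (coord_Sp _ p0 Sf) (coord_Sp _ p0 Sf)).
Qed.

(** Makes the [sup] in [lambda_p] a true supremum, not a default value. *)
Lemma has_ubound_rayleigh p B : 0 < p -> B `<=` @Sp R n p ->
  has_ubound [set rayleigh e p f | f in B].
Proof.
move=> p0 BS; have [c Hc] := edge_sum_bound p0; exists c => _ [f /BS Sf <-].
by rewrite rayleigh_Sp // Hc.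
Qed.

Lemma rayleigh_le_sup p B f : 0 < p -> B `<=` @Sp R n p -> B f ->
  edge_sum e p f <= sup [set rayleigh e p f | f in B].
Proof.
move=> p0 BS Bf; rewrite -rayleigh_Sp; last exact: BS.
by apply: ub_le_sup; [exact: has_ubound_rayleigh|exists f].
Qed.

Lemma lambda_lower p k : 0 < p -> (0 < k)%N ->
  lbound [set sup [set rayleigh e p f | f in B] | B in Fk p k] 0.
Proof.
move=> p0 k0 _ [B [_ _ BS gB] <-].
have [f Bf] := genus_ge_nonempty k0 gB.
exact: le_trans (edge_sum_ge0 p f) (rayleigh_le_sup p0 BS Bf).
Qed.

Lemma lambda_le p k c B : 0 < p -> (0 < k)%N -> Fk p k B ->
  (forall f, B f -> edge_sum e p f <= c) -> lambda_p e p k <= c.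
Proof.
move=> p0 k0 FB Bc; have [_ _ BS gB] := FB.
apply: (@le_trans _ _ (sup [set rayleigh e p f | f in B])).
  by apply: ge_inf; [exists 0; exact: lambda_lower|exists B].
have [f0 Bf0] := genus_ge_nonempty k0 gB.
apply: ge_sup; first by exists (rayleigh e p f0), f0.
by move=> _ [f Bf <-]; rewrite rayleigh_Sp ?Bc //; exact: BS.
Qed.

Lemma lambda_ge_sup p k c : 0 < p -> (k <= n)%N ->
  (forall B, Fk p k B -> c <= sup [set rayleigh e p f | f in B]) ->
  c <= lambda_p e p k.
Proof.
move=> p0 kn Bc; apply: lb_le_inf; last by move=> _ [B FB <-]; exact: Bc.
(* As [k <= n], the sphere itself shows that the infimum is over a nonempty set. *)
by eexists; exists (@Sp R n p) => //; exact: Fk_Sp.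
Qed.

Lemma lambda_ge p k c : 0 < p -> (k <= n)%N ->
  (forall B, Fk p k B -> exists2 f, B f & c <= edge_sum e p f) ->
  c <= lambda_p e p k.
Proof.
move=> p0 kn Bc; apply: lambda_ge_sup => // B FB.
have [f Bf cf] := Bc B FB; have [_ _ BS _] := FB.
exact: le_trans cf (rayleigh_le_sup p0 BS Bf).
Qed.

Lemma lambda_ge0 p k : 0 < p -> (0 < k <= n)%N -> 0 <= lambda_p e p k.
Proof.
move=> p0 /andP[k0 kn]; apply: lambda_ge => // B [_ _ _ gB].
by have [f Bf] := genus_ge_nonempty k0 gB; exists f => //; exact: edge_sum_ge0.
Qed.

Lemma powR_half p (x : R) : 0 <= x -> 2 `^ (- p) * x `^ p = (x / 2) `^ p.
Proof.
by move=> x0; rewrite powRM ?invr_ge0 // mulrC -[2^-1]powR_inv1 // -powRrM mulN1r.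
Qed.

Lemma scaled_edge_sum p f : 2 `^ (- p) * edge_sum e p f =
  \sum_(i < n) \sum_(j < n | (i < j)%N && e i j) (`|f 0 i - f 0 j| / 2) `^ p.
Proof.
rewrite mulr_sumr; apply: eq_bigr => i _; rewrite mulr_sumr.
by apply: eq_bigr => j _; rewrite powR_half.
Qed.

Lemma scaled_edge_sum_vspow p q f : 0 < p -> p <= q ->
  2 `^ (- q) * edge_sum e q f <= 2 `^ (- p) * edge_sum e p (vspow (q / p) f).
Proof.
move=> p0 pq; have qp1 : 1 <= q / p by rewrite ler_pdivlMr // mul1r.
rewrite !scaled_edge_sum; apply: ler_sum => i _; apply: ler_sum => j _.
rewrite !mxE; have -> : q = (q / p) * p by rewrite divfK ?gt_eqF.
rewrite powRrM mulfK ?gt_eqF //.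
by apply: ge0_ler_powR; rewrite ?nnegrE ?powR_ge0 ?divr_ge0 ?(ltW p0) ?powR_dist_half.
Qed.

(** The preimage under the power q/p of a competitor [B] for [p] is a competitor for [q], with no
    larger scaled energy. *)
Lemma scaled_lambda_nonincreasing k p q : (0 < k <= n)%N -> 0 < p -> p <= q ->
  2 `^ (- q) * lambda_p e q k <= 2 `^ (- p) * lambda_p e p k.
Proof.
move=> /andP[k0 kn] p0 pq; have q0 : 0 < q by exact: lt_le_trans pq.
have pow2 r : 0 < 2 `^ r :> R by exact: powR_gt0.
have pow2K r x : 2 `^ (- r) * x = x / 2 `^ r by rewrite powRN mulrC.
rewrite [leRHS]pow2K ler_pdivlMr // mulrC.
apply: lambda_ge_sup => // B FB; have [_ _ BS _] := FB.
rewrite mulrC -ler_pdivlMr // -pow2K.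
rewrite [leLHS]pow2K ler_pdivrMr // mulrC.
apply: lambda_le (Fk_vspow p0 q0 FB) _ => // f Bf.
rewrite -ler_pdivrMl // -powRN.
apply: le_trans (scaled_edge_sum_vspow _ p0 pq) _.
by rewrite ler_pM2l //; exact: rayleigh_le_sup.
Qed.

Lemma is_cvg_scaled_lambda k : (0 < k <= n)%N ->
  cvg ((fun p : R => 2 `^ (- p) * lambda_p e p k) @ +oo).
Proof.
(* Monotonicity holds for positive exponents, hence the truncation at 1; the sign makes [g]
   nondecreasing. *)
move=> kn; pose g p := - (2 `^ (- Num.max 1 p) * lambda_p e (Num.max 1 p) k).
have max_gt0 p : 0 < Num.max 1 p :> R by rewrite lt_max ltr01.
have /cvgN gcvg : g @ +oo --> sup (range g).
  apply: nondecreasing_cvgr.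
    move=> p q pq; rewrite lerN2; apply: scaled_lambda_nonincreasing => //.
    by rewrite ge_max !le_max lexx pq orbT.
  exists 0 => _ [p _ <-].
  by rewrite oppr_le0 mulr_ge0 ?powR_ge0 ?lambda_ge0.
apply: (cvgP (- sup (range g))); apply: cvg_trans gcvg; apply: near_eq_cvg.
have : \forall p \near +oo, (1 : R) <= p by apply: nbhs_pinfty_ge; exact: num_real.
by apply: filterS => p p1; rewrite /= opprK max_r.
Qed.

Lemma Lcut_ge k c : (0 < k <= n)%N ->
  (forall p, 1 <= p -> c <= 2 `^ (- p) * lambda_p e p k) -> c <= Lcut R e k.
Proof.
move=> kn Hc; apply: limr_ge (is_cvg_scaled_lambda kn) _.
have : \forall p \near +oo, (1 : R) <= p by apply: nbhs_pinfty_ge; exact: num_real.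
exact: filterS.
Qed.

Lemma Lcut_squeeze k p0 c (u : R -> R) :
  (forall p, p0 < p -> c <= 2 `^ (- p) * lambda_p e p k <= u p) ->
  u p @[p --> +oo] --> c -> Lcut R e k = c.
Proof.
move=> cu uc; apply: cvg_lim => //; apply: (squeeze_cvgr _ (cvg_cst c) uc).
have : \forall p \near +oo, p0 < p by apply: nbhs_pinfty_gt; exact: num_real.
exact: filterS.
Qed.

End Eigenvalues.

Lemma cvg_powR2N (R : realType) : 2 `^ (- p) @[p --> +oo] --> (0 : R).
Proof.
have ln2 : 0 < ln 2 :> R by rewrite ln_gt0 // ltr1n.
have -> : (fun p : R => 2 `^ (- p)) = (fun x => expR (- x)) \o (fun p => ln 2 * p).
  by apply/funext => p /=; rewrite /powR pnatr_eq0 /= mulNr mulrC.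
apply: cvg_comp; last exact: cvgr_expR.
apply: gt0_cvgMry => //; exact: cvg_id.
Qed.

(** * Edge energies and lower bounds for L_{n-1} *)

Section Graphs.
Variables (R : realType) (n : nat) (e : rel 'I_n).
Hypothesis hG : simple_graph e.
Implicit Types (f : 'rV[R]_n) (p q c : R) (B : set 'rV[R]_n).

Definition tension p f i j := (`|f 0 i - f 0 j| / 2) `^ p.

Lemma tension_ge0 p f i j : 0 <= tension p f i j.
Proof. exact: powR_ge0. Qed.

Lemma tensionC p f i j : tension p f i j = tension p f j i.
Proof. by rewrite /tension distrC. Qed.

Lemma tension_amgm p f i j : 0 < p ->
  - (spow (p / 2) (f 0 i) * spow (p / 2) (f 0 j)) <= tension p f i j.
Proof. exact: amgm_spow. Qed.

(** Ordered pairs remove the condition i < j, so edges can be listed in either direction. *)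
Lemma scaled_edge_sum_double p f :
  2 * (2 `^ (- p) * edge_sum e p f) = \sum_(ij | e ij.1 ij.2) tension p f ij.1 ij.2.
Proof.
rewrite scaled_edge_sum mulr_natl mulr2n.
have [esym eirr] := hG.
pose a (i j : 'I_n) := if (i < j)%N && e i j then tension p f i j else 0.
have -> : \sum_(i < n) \sum_(j < n | (i < j)%N && e i j) tension p f i j = \sum_i \sum_j a i j.
  by apply: eq_bigr => i _; rewrite big_mkcond.
rewrite -(pair_big_dep xpredT (fun i j => e i j) (fun i j => tension p f i j)) /=.
rewrite [X in _ + X]exchange_big -big_split; apply: eq_bigr => i _ /=.
rewrite -big_split [RHS]big_mkcond; apply: eq_bigr => j _ /=.
rewrite /a (esym j i) (tensionC p f j i).
case: (ltngtP i j) => [ij|ij|/val_inj ->] /=; rewrite ?addr0 ?add0r //.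
by rewrite (negPf (eirr j)).
Qed.

Lemma ler_edge_list p f (r : seq ('I_n * 'I_n)) : uniq r ->
  (forall ij, ij \in r -> e ij.1 ij.2) ->
  \sum_(ij <- r) tension p f ij.1 ij.2 <= 2 * (2 `^ (- p) * edge_sum e p f).
Proof.
move=> ur re; rewrite scaled_edge_sum_double big_uniq //=.
rewrite [leRHS](bigID (mem r)) /= -[leLHS]addr0 lerD ?sumr_ge0 // => [|ij _]; last first.
  exact: tension_ge0.
rewrite le_eqVlt; apply/orP; left; apply/eqP; apply: eq_bigl => ij.
by case ijr: (ij \in r); rewrite ?andbF // re.
Qed.

Lemma spow_sqr_sum p f : 0 < p -> Sp p f -> \sum_i spow (p / 2) (f 0 i) ^+ 2 = 1.
Proof.
move=> p0 Sf; rewrite -[RHS]Sf; apply: eq_bigr => i _.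
rewrite -real_normK ?num_real // normr_spow ?divr_gt0 // -powR_mulrn ?powR_ge0 //.
by rewrite -powRrM divfK.
Qed.

(** Compares n-2 constraints, one at each vertex other than [x] and [y], with genus n-1. *)
Lemma ltn_cardsC2 (x y : 'I_n) : x != y -> (#|~: [set x; y]%SET| < n.-1)%N.
Proof.
move=> xy; have := cardsC [set x; y]%SET; rewrite cards2 xy card_ord.
by move: #|~: _| => k <-.
Qed.

(* Constraining g_a + g_b = g_c + g_d = 0 and g_i = 0 elsewhere leaves
   - g_a g_b - g_c g_d = 1/2 on the unit sphere. *)
Lemma disjoint_edges_ge (a b c d : 'I_n) p : 0 < p -> e a b -> e c d ->
  [&& a != c, a != d, b != c & b != d] ->
  1 / 2 <= 2 `^ (- p) * lambda_p e p n.-1.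
Proof.
move=> p0 eab ecd /and4P[ac ad bc bd].
have [esym eirr] := hG.
have ab : a != b by apply: contraTneq eab => ->.
have cd : c != d by apply: contraTneq ecd => ->.
have pow2 : 0 < 2 `^ (- p) :> R by exact: powR_gt0.
rewrite [leRHS]mulrC -ler_pdivrMr //; apply: lambda_ge => //; first exact: leq_pred.
move=> B [_ _ BS gB]; pose g f i := spow (p / 2) (f 0 i).
(* Constraints sit at all vertices but [a] and [c]; those at [b] and [d] tie each edge together. *)
pose phi i f := if i == b then g f a + g f b else if i == d then g f c + g f d else g f i.
have cg i : continuous (g^~ i) by apply: continuous_coord_spow; rewrite divr_gt0.
have oddg f i : g (- f) i = - g f i by rewrite /g mxE spowN.
have D_lt := ltn_cardsC2 ac.
have [i|i f|f Bf fD] := genus_ge_zero (phi := phi) gB D_lt.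
- rewrite /phi; case: eqP => _; first by apply: continuous_addr; exact: cg.
  by case: eqP => _; [apply: continuous_addr|]; exact: cg.
- by rewrite /phi !oddg; case: eqP => _; [|case: eqP => _]; rewrite ?opprD.
exists f => //; rewrite ler_pdivrMr // [leRHS]mulrC.
have gab : g f a + g f b = 0.
  by have := fD b; rewrite /phi eqxx !inE negb_or eq_sym ab bc; exact.
have gcd : g f c + g f d = 0.
  have := fD d; rewrite /phi eqxx !inE negb_or (eq_sym d b) (negPf bd).
  by rewrite (eq_sym d a) ad eq_sym cd; exact.
have g0 i : i \notin [:: a; b; c; d] -> g f i = 0.
  rewrite !inE !negb_or => /and4P[ia ib ic id].
  by have := fD i; rewrite /phi (negPf ib) (negPf id) !inE negb_or ia ic; exact.
have edges : tension p f a b + tension p f c d <= 2 `^ (- p) * edge_sum e p f.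
  have := @ler_edge_list p f [:: (a, b); (b, a); (c, d); (d, c)].
  rewrite !big_cons big_nil /= (tensionC p f b a) (tensionC p f d c).
  rewrite !inE !xpair_eqE (negPf ab) (negPf ac) (negPf ad) (negPf bc) (negPf bd) (negPf cd) /=.
  rewrite ?andbF /= => /(_ isT) H.
  suff : forall ij : 'I_n * 'I_n, ij \in [:: (a, b); (b, a); (c, d); (d, c)] -> e ij.1 ij.2.
    by move/H; lra.
  by move=> ij; rewrite !inE => /or4P[] /eqP -> //=; rewrite esym.
apply: le_trans edges.
have uabcd : uniq [:: a; b; c; d].
  by rewrite /= !inE !negb_or ab ac ad bc bd cd.
have := spow_sqr_sum p0 (BS f Bf).
rewrite (bigID (mem [:: a; b; c; d])) /= [X in _ + X]big1 => [|i /g0 gi]; last first.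
  by rewrite -/(g f i) gi expr0n.
rewrite -big_uniq // !big_cons big_nil /= -!/(g f _) !addr0.
have := tension_amgm f a b p0; have := tension_amgm f c d p0; rewrite -!/(g f _).
move: (tension _ _ _ _) (tension _ _ _ _) (g f a) (g f b) (g f c) (g f d) gab gcd.
move=> u v ga gb gc gd.
move=> /eqP; rewrite addrC addr_eq0 => /eqP -> /eqP; rewrite addrC addr_eq0 => /eqP ->.
rewrite !expr2; lra.
Qed.

(* Constraining g_a + g_b + g_c = 0 and g_i = 0 elsewhere leaves
   - g_a g_b - g_b g_c - g_c g_a = 1/2 on the unit sphere. *)
Lemma triangle_ge (a b c : 'I_n) p : 0 < p -> e a b -> e b c -> e c a ->
  1 / 2 <= 2 `^ (- p) * lambda_p e p n.-1.
Proof.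
move=> p0 eab ebc eca.
have [esym eirr] := hG.
have ab : a != b by apply: contraTneq eab => ->.
have bc : b != c by apply: contraTneq ebc => ->.
have ac : a != c by apply: contraTneq eca => ->.
have pow2 : 0 < 2 `^ (- p) :> R by exact: powR_gt0.
rewrite [leRHS]mulrC -ler_pdivrMr //; apply: lambda_ge => //; first exact: leq_pred.
move=> B [_ _ BS gB]; pose g f i := spow (p / 2) (f 0 i).
(* Constraints sit at all vertices but [a] and [b]; the one at [c] carries the sum. *)
pose phi i f := if i == c then g f a + g f b + g f c else g f i.
have cg i : continuous (g^~ i) by apply: continuous_coord_spow; rewrite divr_gt0.
have oddg f i : g (- f) i = - g f i by rewrite /g mxE spowN.
have D_lt := ltn_cardsC2 ab.
have [i|i f|f Bf fD] := genus_ge_zero (phi := phi) gB D_lt.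
- rewrite /phi; case: eqP => _; last exact: cg.
  by apply: continuous_addr; [apply: continuous_addr|]; exact: cg.
- by rewrite /phi !oddg; case: eqP => _; rewrite ?opprD.
exists f => //; rewrite ler_pdivrMr // [leRHS]mulrC.
have gabc : g f a + g f b + g f c = 0.
  by have := fD c; rewrite /phi eqxx !inE negb_or ![c == _]eq_sym ac bc; exact.
have g0 i : i \notin [:: a; b; c] -> g f i = 0.
  rewrite !inE !negb_or => /and3P[ia ib ic].
  by have := fD i; rewrite /phi (negPf ic) !inE negb_or ia ib; exact.
have edges : tension p f a b + tension p f b c + tension p f c a <=
    2 `^ (- p) * edge_sum e p f.
  pose r := [:: (a, b); (b, a); (b, c); (c, b); (c, a); (a, c)].
  have := @ler_edge_list p f r.
  rewrite /r !big_cons big_nil /= (tensionC p f b a) (tensionC p f c b) (tensionC p f a c).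
  rewrite !inE !xpair_eqE ![b == a]eq_sym ![c == _]eq_sym (negPf ab) (negPf ac) (negPf bc) /=.
  rewrite ?andbF /= => /(_ isT) H.
  suff : forall ij, ij \in r -> e ij.1 ij.2 by move/H; lra.
  move=> ij; rewrite !inE.
  by do 5?[case/orP => [/eqP-> //=|]]; try (by rewrite esym); move/eqP ->; rewrite /= esym.
apply: le_trans edges.
have uabc : uniq [:: a; b; c] by rewrite /= !inE !negb_or ab ac bc.
have := spow_sqr_sum p0 (BS f Bf).
rewrite (bigID (mem [:: a; b; c])) /= [X in _ + X]big1 => [|i /g0 gi]; last first.
  by rewrite -/(g f i) gi expr0n.
rewrite -big_uniq // !big_cons big_nil /= -!/(g f _) !addr0.
have := tension_amgm f a b p0; have := tension_amgm f b c p0; have := tension_amgm f c a p0.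
rewrite -!/(g f _).
move: (tension _ _ _ _) (tension _ _ _ _) (tension _ _ _ _) (g f a) (g f b) (g f c) gabc.
(* The square of the zero sum is the sum of squares, 1, plus twice the sum of the products. *)
move=> u v w ga gb gc gabc; have -> : gc = - (ga + gb) by lra.
rewrite !expr2; lra.
Qed.

End Graphs.

(** * Stars *)

Section Star.
Variables (R : realType) (n : nat) (e : rel 'I_n) (c : 'I_n) (S : {set 'I_n}).
Hypothesis cS : c \notin S.
Hypothesis eE : forall i j, e i j = ((i == c) && (j \in S)) || ((j == c) && (i \in S)).
Implicit Types (f : 'rV[R]_n) (p : R).

Let m : R := #|S|%:R.

Lemma simple_star : simple_graph e.
Proof.
split=> [i j|i]; first by rewrite !eE orbC.
by rewrite eE orbb; apply: contra cS => /andP[/eqP<-].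
Qed.

Lemma scaled_edge_sum_star p f :
  2 `^ (- p) * edge_sum e p f = \sum_(i in S) tension p f c i.
Proof.
apply: (@mulfI _ 2); first by rewrite pnatr_eq0.
rewrite (scaled_edge_sum_double simple_star).
rewrite -(pair_big_dep xpredT (fun i j => e i j) (fun i j => tension p f i j)) /=.
(* The row of the centre and the rows of the leaves each give the sum once. *)
rewrite (bigD1 c) //= mulr_natl mulr2n; congr (_ + _).
  by apply: eq_bigl => j; rewrite eE eqxx (negPf cS) andbF orbF.
rewrite [RHS](big_mkcond (fun i => i \in S)) [RHS](bigD1 c) //= (negPf cS) add0r.
apply: eq_bigr => i ic; case: ifP => iS; last first.
  by rewrite big1 // => j; rewrite eE (negPf ic) iS andbF.
rewrite (big_pred1 c) => [|j]; first by rewrite tensionC.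
by rewrite eE (negPf ic) iS andbT.
Qed.

Lemma edge_sum_star p f : edge_sum e p f = \sum_(i in S) `|f 0 c - f 0 i| `^ p.
Proof.
apply: (@mulfI _ (2 `^ (- p))); first by rewrite gt_eqF ?powR_gt0.
rewrite scaled_edge_sum_star mulr_sumr; apply: eq_bigr => i _.
by rewrite powR_half.
Qed.

Lemma pnorm_star p f : `|f 0 c| `^ p + \sum_(i in S) `|f 0 i| `^ p <= pnorm_p p f.
Proof.
rewrite /pnorm_p [leRHS](bigD1 c) //= lerD2l big_mkcond [leRHS]big_mkcond.
apply: ler_sum => i _; case: ifP => iS; last by case: ifP => // _; exact: powR_ge0.
by rewrite ifT //; apply: contraNneq cS => <-.
Qed.

(* On the unit sphere, sqrt m g_i + g_c = 0 at the leaves and g_i = 0 at the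
   isolated vertices force - g_c * \sum g_i = sqrt m / 2. *)
Lemma star_lambda_ge p : 0 < p -> (0 < #|S|)%N ->
  Num.sqrt m / 2 <= 2 `^ (- p) * lambda_p e p n.
Proof.
move=> p0 S0; have m0 : 0 < m by rewrite ltr0n.
have pow2 : 0 < 2 `^ (- p) :> R by exact: powR_gt0.
rewrite [leRHS]mulrC -ler_pdivrMr //; apply: lambda_ge => // B [_ _ BS gB].
pose g f i := spow (p / 2) (f 0 i).
pose phi i f := if i \in S then Num.sqrt m * g f i + g f c else g f i.
have cg i : continuous (g^~ i) by apply: continuous_coord_spow; rewrite divr_gt0.
have oddg f i : g (- f) i = - g f i by rewrite /g mxE spowN.
have D_lt : (#|~: [set c]%SET| < n)%N.
  have := cardsC [set c]%SET; rewrite cards1 card_ord.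
  by move: #|~: _| => k <-.
have [i|i f|f Bf fD] := genus_ge_zero (phi := phi) gB D_lt.
- rewrite /phi; case: (i \in S); last exact: cg.
  apply: continuous_addr; last exact: cg.
  by apply: continuous_mulr_cst; exact: cg.
- by rewrite /phi !oddg; case: ifP => _ //; rewrite opprD mulrN.
exists f => //; rewrite ler_pdivrMr // [leRHS]mulrC scaled_edge_sum_star.
have s0 : 0 < Num.sqrt m by rewrite sqrtr_gt0.
have gc i : i \in S -> g f c = - (Num.sqrt m * g f i).
  move=> iS; have := fD i; rewrite /phi iS !inE.
  have -> : i != c by apply: contraNneq cS => <-.
  by move=> /(_ isT)/eqP; rewrite addrC addr_eq0 => /eqP.
(* The constraints squared read m g_i^2 = g_c^2 at each of the m leaves. *)
have leaves : \sum_(i in S) g f i ^+ 2 = g f c ^+ 2.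
  apply: (@mulfI _ m); first by rewrite gt_eqF.
  rewrite mulr_sumr (eq_bigr (fun=> g f c ^+ 2)) => [|i iS].
    by rewrite sumr_const mulr_natl.
  by rewrite (gc i iS) sqrrN [RHS]exprMn sqr_sqrtr // ltW.
have total : \sum_(i in S) g f i ^+ 2 = 1 / 2.
  have := spow_sqr_sum p0 (BS f Bf).
  rewrite (bigD1 c) //= -/(g f c) (bigID (mem S)) /=.
  rewrite [X in _ + (_ + X)]big1 => [|i /andP[ic iS]]; last first.
    have := fD i; rewrite /phi (negPf iS) !inE ic => /(_ isT).
    by rewrite -/(g f i) => ->; rewrite expr0n.
  rewrite (eq_bigl (fun i => i \in S)) => [|i]; last first.
    rewrite andbC; case iS: (i \in S) => //=.
    by apply/eqP => ic; move: cS; rewrite -ic iS.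
  by rewrite addr0 -[X in _ + X]/(\sum_(i in S) g f i ^+ 2) leaves; lra.
have -> : Num.sqrt m / 2 = \sum_(i in S) Num.sqrt m * g f i ^+ 2.
  by rewrite -mulr_sumr total mul1r.
apply: ler_sum => i iS; apply: le_trans (tension_amgm f c i p0).
by rewrite -!/(g f _) (gc i iS) mulNr opprK -mulrA expr2.
Qed.

(* The extremal weight u = m^(1/(p-1)) makes both terms of the convexity bound equal. *)
Lemma star_lambda_le p : 1 < p -> (0 < #|S|)%N ->
  lambda_p e p n <= (1 + m `^ (p - 1)^-1) `^ (p - 1).
Proof.
move=> p1 S0; have m0 : 0 < m by rewrite ltr0n.
have p0 : 0 < p by exact: lt_trans p1.
have n0 : (0 < n)%N by exact: leq_ltn_trans (leq0n c) (ltn_ord c).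
set u := m `^ _; have u0 : 0 < u by exact: powR_gt0.
apply: (lambda_le p0 n0 (Fk_Sp p0 (leqnn n))) => f Sf.
rewrite edge_sum_star.
(* With weight 1/m, the m copies of the centre term add up to |f(c)|^p. *)
have um : u `^ (1 - p) = m^-1.
  rewrite /u -powRrM (_ : (p - 1)^-1 * (1 - p) = -1) ?powR_inv1 ?(ltW m0) //.
  by field; rewrite subr_eq0 gt_eqF.
apply: (@le_trans _ _ (\sum_(i in S) (1 + u) `^ (p - 1) *
    (m^-1 * `|f 0 c| `^ p + `|f 0 i| `^ p))).
  apply: ler_sum => i _; rewrite -um.
  apply: le_trans (powRD_weighted p1 u0 (normr_ge0 _) (normr_ge0 _)).
  by rewrite ge0_ler_powR ?nnegrE ?(ltW p0) ?addr_ge0 // ler_normB.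
rewrite -mulr_sumr ger_pMr ?powR_gt0 ?addr_gt0 //.
rewrite big_split /= sumr_const -[_ *+ #|_|]mulr_natl mulrA divff ?gt_eqF // mul1r.
by rewrite -[leRHS]Sf; exact: pnorm_star.
Qed.

(** With L = ln m, x = L/(p-1) and u = exp x, the upper bound is ((1+u)/2)^(p-1) / 2. Using 1 + y <=
    exp y at (u-1)/2 and at -x bounds it by exp(L/(2(1-x))) / 2, which tends to sqrt m / 2. *)
Lemma Lcut_star_top : (0 < #|S|)%N -> Lcut R e n = Num.sqrt m / 2.
Proof.
move=> S0; have m1 : 1 <= m by rewrite ler1n.
have m0 : 0 < m by exact: lt_le_trans m1.
pose L := ln m; have L0 : 0 <= L by exact: ln_ge0.
(* The threshold p > 1 + L ensures x < 1. *)
apply: (@Lcut_squeeze R n e n (1 + L) _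
  (fun p => 2^-1 * expR (L / 2 * (1 - L * (p - 1)^-1)^-1))) => [p pL|].
  have p1 : 0 < p - 1 by lra.
  have pL1 : L < p - 1 by lra.
  have p0 : 0 < p by lra.
  rewrite star_lambda_ge //=.
  have lt1p : 1 < p by lra.
  apply: (@le_trans _ _ (2 `^ (- p) * (1 + m `^ (p - 1)^-1) `^ (p - 1))).
    by rewrite ler_pM2l ?powR_gt0 //; exact: star_lambda_le.
  set u := m `^ _; have u0 : 0 < u by exact: powR_gt0.
  have -> : - p = -1 + - (p - 1) by lra.
  rewrite [2 `^ _]powRD; last by rewrite pnatr_eq0 implybT.
  rewrite powR_inv1 // -mulrA ler_pM2l ?invr_gt0 //.
  rewrite powR_half; last by rewrite addr_ge0 // ltW.
  set x := L * (p - 1)^-1.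
  have uE : u = expR x by rewrite /u /powR gt_eqF // mulrC.
  have x1 : x < 1 by rewrite ltr_pdivrMr // mul1r.
  have u_le : u <= (1 - x)^-1.
    rewrite uE -[expR x]invrK -expRN lef_pV2 ?posrE ?expR_gt0 ?subr_gt0 //.
    exact: expR_ge1Dx.
  have half_le : (1 + u) / 2 <= expR ((u - 1) / 2).
    by apply: le_trans (expR_ge1Dx _); lra.
  apply: (@le_trans _ _ (expR ((u - 1) / 2) `^ (p - 1))).
    apply: ge0_ler_powR; rewrite ?nnegrE ?(ltW p1) ?expR_ge0 ?half_le //.
    by rewrite divr_ge0 ?addr_ge0 ?(ltW u0).
  rewrite -expRM ler_expR.
  have -> : L / 2 * (1 - x)^-1 = ((1 - x)^-1 - 1) / 2 * (p - 1).
    rewrite /x; field.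
    by rewrite !gt_eqF //; lra.
  by rewrite ler_pM2r // ler_pM2r ?invr_gt0 // lerD2r.
have -> : Num.sqrt m / 2 = 2^-1 * expR (L / 2 * (1 - L * 0)^-1).
  rewrite mulr0 subr0 invr1 mulr1 mulrC -powR12_sqrt ?(ltW m0) // /powR gt_eqF //.
  by rewrite mulrC -/L mulrC [2^-1 * L]mulrC.
apply: cvgMr; apply: (@cvg_comp _ _ _ _ expR); last exact: continuous_expR.
apply: cvgMr; apply: cvgV; first by rewrite mulr0 subr0 oner_eq0.
apply: cvgB; first exact: cvg_cst.
apply: cvgMr; apply/gtr0_cvgV0; last exact: cvg_addrr.
have : \forall p \near +oo, (1 : R) < p by apply: nbhs_pinfty_gt; exact: num_real.
by apply: filterS => p; rewrite subr_gt0.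
Qed.

End Star.

(** On the hyperplane the energy is the sum of |f(i)|^p over the leaves, at most 1, so the scaled
    eigenvalue is at most 2^-p. *)
Lemma Lcut_star_low (R : realType) n (e : rel 'I_n) (c : 'I_n) (S : {set 'I_n}) k :
  c \notin S ->
  (forall i j, e i j = ((i == c) && (j \in S)) || ((j == c) && (i \in S))) ->
  (0 < k < n)%N -> Lcut R e k = 0.
Proof.
case: n e c S => [|n] e c S cS eE; first by rewrite ltn0 andbF.
rewrite ltnS => /andP[k0 kn].
apply: (@Lcut_squeeze R n.+1 e k 1 _ (fun p => 2 `^ (- p))) => [p p1|]; last exact: cvg_powR2N.
have p0 : 0 < p by exact: lt_trans p1.
rewrite mulr_ge0 ?powR_ge0 ?lambda_ge0 ?k0 ?(leqW kn) //=.
rewrite -[leRHS]mulr1 ler_pM2l ?powR_gt0 //.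
apply: (lambda_le p0 k0 (Fk_hyperplane c p0 kn)) => f [Sf fc].
rewrite (edge_sum_star cS eE); apply: le_trans (_ : pnorm_p p f <= _); last by rewrite Sf.
apply: le_trans (pnorm_star cS p f); rewrite fc normr0 powR0 ?gt_eqF // add0r.
by under eq_bigr do rewrite sub0r normrN.
Qed.

(** * Graphs that are not stars, and the equivalence *)

Lemma Lcut_edgeless (R : realType) n (e : rel 'I_n) k :
  (0 < k <= n)%N -> (forall i j, ~~ e i j) -> Lcut R e k = 0.
Proof.
move=> /andP[k0 kn] e0.
apply: (@Lcut_squeeze R n e k 1 _ (fun=> 0)) => [p p1|]; last exact: cvg_cst.
have p0 : 0 < p by exact: lt_trans p1.
rewrite mulr_ge0 ?powR_ge0 ?lambda_ge0 ?k0 //=.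
apply: mulr_ge0_le0; rewrite ?powR_ge0 //; apply: (lambda_le p0 k0 (Fk_Sp p0 kn)) => f _.
by rewrite /edge_sum big1 // => i _; rewrite big1 // => j; rewrite (negPf (e0 i j)) andbF.
Qed.

(** If no vertex meets all edges, some edge avoids [a] and some edge avoids [b]. Either one of them
    is disjoint from ab, or they are b j and a l. *)
Lemma star_or_disjoint_or_triangle n (e : rel 'I_n) (a b : 'I_n) :
  simple_graph e -> e a b ->
  [\/ exists m, star_plus_isolated e m,
      exists x y z t, [/\ e x y, e z t & [&& x != z, x != t, y != z & y != t]] |
      exists x y z, [/\ e x y, e y z & e z x]].
Proof.
move=> [esym eirr] eab; have neq i j : e i j -> i != j.
  by move=> eij; apply: contraTneq eij => ->.
have [[c cover]|nocover] := pselect (exists c, forall i j, e i j -> (i == c) || (j == c)).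
  apply: Or31; exists #|[set j | e c j]%SET|, c, [set j | e c j]%SET; split=> //.
    by rewrite inE.
  move=> i j; rewrite !inE; apply/idP/orP => [eij|[/andP[/eqP->]|/andP[/eqP->]]] //.
    by case/orP: (cover i j eij) => /eqP <-; [left|right]; rewrite eqxx //= esym.
  by rewrite esym.
have avoid c : exists i j, [/\ e i j, i != c & j != c].
  apply: contrapT => H; apply: nocover; exists c => i j eij.
  apply: contrapT => /negP; rewrite negb_or => /andP[ic jc].
  by apply: H; exists i, j.
have avoid_at c d : e c d -> (exists j, [/\ e d j, d != c & j != c]) \/
    (exists i j, [/\ e i j & [&& c != i, c != j, d != i & d != j]]).
  move=> ecd; have [i [j [eij ic jc]]] := avoid c.
  have [di|di] := eqVneq d i; first by left; exists j; rewrite di.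
  have [dj|dj] := eqVneq d j; first by left; exists i; rewrite dj esym.
  by right; exists i, j; rewrite eij di dj ![c == _]eq_sym ic jc.
have [[j [ebj ba ja]]|[i [j [eij dis]]]] := avoid_at a b eab; last first.
  by apply: Or32; exists a, b, i, j.
have eba : e b a by rewrite esym.
have [[l [eal ab lb]]|[i [k [eik dis]]]] := avoid_at b a eba; last first.
  by apply: Or32; exists b, a, i, k.
(* The edges a l and b j close a triangle with ab if l = j, and are disjoint otherwise. *)
have [lj|lj] := eqVneq l j.
  by apply: Or33; exists a, b, j; rewrite eab ebj -lj (esym l a) eal.
by apply: Or32; exists a, l, b, j; rewrite ab lb lj eq_sym ja.
Qed.

Theorem theorem8p9 (R : realType) (n : nat) (e : rel 'I_n)
  (hG : simple_graph e) (hn : (0 < n)%N) (C : R) (hC : 0 < C) :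
  ((forall k : nat, (1 <= k < n)%N -> Lcut R e k = 0) /\ Lcut R e n = C) <->
  (exists m : nat, m%:R = 4 * C ^+ 2 /\ star_plus_isolated e m).
Proof.
split=> [[Llow Ltop]|[m [mC [c [S [Sm cS eE]]]]]]; last first.
  split=> [k kn|]; first exact: Lcut_star_low cS eE kn.
  have S0 : (0 < #|S|)%N by rewrite Sm -(ltr0n R) mC mulr_gt0 ?exprn_gt0.
  rewrite (Lcut_star_top R cS eE S0) Sm mC.
  have -> : 4 * C ^+ 2 = (2 * C) ^+ 2 by ring.
  by rewrite sqrtr_sqr gtr0_norm ?mulr_gt0 // mulrC mulKf ?pnatr_eq0.
(* Without edges L_n would be 0, against C > 0. *)
have [[a [b eab]]|noedge] := pselect (exists a b, e a b); last first.
  move: hC; rewrite -Ltop Lcut_edgeless ?ltxx ?hn ?leqnn // => i j.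
  by apply/negP => eij; apply: noedge; exists i, j.
(* An edge needs two vertices, so n-1 is among the indices where the limit is assumed to vanish. *)
have n1 : (1 <= n.-1 < n)%N.
  have ab : a != b by apply: contraTneq eab => ->; have [_] := hG.
  case: n a b ab {e hG hn Llow Ltop eab} => [[]//|[|n] a b ab]; last by rewrite /= ltnSn.
  by rewrite (ord1 a) (ord1 b) eqxx in ab.
have n1' : (0 < n.-1 <= n)%N by case/andP: n1 => -> /ltnW.
have low_lt : Lcut R e n.-1 < 1 / 2 by rewrite (Llow _ n1) divr_gt0.
have [[m star]|[x [y [z [t [exy ezt dis]]]]]|[x [y [z [exy eyz ezx]]]]] :=
  star_or_disjoint_or_triangle hG eab.
- exists m; split=> //; have [c [S [Sm cS eE]]] := star.
  have S0 : (0 < #|S|)%N.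
    rewrite card_gt0; apply/set0Pn; move: eab; rewrite eE.
    by move=> /orP[]/andP[_ ?]; [exists b|exists a].
  rewrite -Ltop (Lcut_star_top R cS eE S0) Sm expr_div_n sqr_sqrtr //.
  by field.
- suff : 1 / 2 <= Lcut R e n.-1 by rewrite leNgt low_lt.
  apply: Lcut_ge n1' _ => p p1.
  by apply: (disjoint_edges_ge hG _ exy ezt dis); exact: lt_le_trans p1.
- suff : 1 / 2 <= Lcut R e n.-1 by rewrite leNgt low_lt.
  apply: Lcut_ge n1' _ => p p1.
  by apply: (triangle_ge hG _ exy eyz ezx); exact: lt_le_trans p1.
Qed.
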